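(* Let $A>0$ be a real number, let $n\ge 2$, let $U\subset\mathbb R^n$ be an open subset and let $K\subset U$ be a compact subset. Then there exists an integer $N$ such that for every tropical curve $G$ in $U$ with $\operatorname{Area}(G)\le A$, the number of vertices of $G$ lying in $K$ is at most $N$.
   Context: Let $W$ be the quotient of $\mathbb Z^n\setminus\{0\}$ by the action $w\mapsto -w$ of $\mathbb Z/2\mathbb Z$; for $w\in W$ with representative $(w^1,\dots,w^n)$ put $|w|=\sqrt{\sum_i (w^i)^2}$. A tropical curve $G$ in an open subset $U\subset\mathbb R^n$ is a finite one-dimensional polyhedral complex in $U$ such that: (i) $G$ is closed in $U$; its $0$-dimensional faces are called vertices and its $1$-dimensional faces edges; (ii) every vertex is at least $3$-valent; (iii) each edge $e$ carries a weight $w_e\in W$ parallel to the direction of $e$ (if $w_e$ is $k$ times a primitive integral vector, $|k|$ is the multiplicity of $e$); (iv) balancing: for every vertex $v$, $\sum_{e\ni v}\widetilde w_e=0$, where the sum is over the edges having $v$ as an endpoint and $\widetilde w_e$ is the representative of $w_e$ pointing away from $v$. The (tropical) area of an edge $e$ is $\operatorname{Area}(e)=|e|\cdot|w_e|$, where $|e|$ is the Euclidean length of $e$; the area of $G$ is the sum of the areas of all its edges. *)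

(* Defs.v *)
From HB Require Import structures.
From mathcomp Require Import all_boot all_order all_algebra.
From mathcomp Require Import all_classical all_reals all_analysis.

Set Implicit Arguments.
Unset Strict Implicit.
Unset Printing Implicit Defensive.

Import Order.TTheory GRing.Theory Num.Theory.
Import numFieldNormedType.Exports.

Local Open Scope classical_set_scope.
Local Open Scope card_scope.
Local Open Scope ring_scope.

(* The library norm on row vectors is the sup norm, hence this definition; the
   topology of 'rV[R]_n is the usual one in either case. *)
Definition enorm (R : rcfType) (n : nat) (x : 'rV[R]_n) : R :=
  Num.sqrt (\sum_(i < n) x ord0 i ^+ 2).

Definition nzvec (n : nat) := {w : 'rV[int]_n | w != 0}.

Section Weights.
Variable n : nat.

Definition eq_pm (u v : nzvec n) : bool :=
  (val u == val v) || (val u == - val v).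

Lemma eq_pm_refl : reflexive eq_pm.
Proof. by move=> u; rewrite /eq_pm eqxx. Qed.

Lemma eq_pm_sym : symmetric eq_pm.
Proof.
by move=> u v; rewrite /eq_pm eq_sym; congr (_ || _); rewrite -eqr_oppLR eq_sym.
Qed.

Lemma eq_pm_trans : transitive eq_pm.
Proof.
move=> v u w; rewrite /eq_pm => /orP[]/eqP-> /orP[]/eqP->;
by rewrite ?opprK eqxx ?orbT.
Qed.

Canonical eq_pm_equiv := EquivRel eq_pm eq_pm_refl eq_pm_sym eq_pm_trans.

(* The quotient of Z^n \ {0} by w |-> - w. *)
Definition weight := {eq_quot eq_pm}%qT.

Definition wrepr (w : weight) : 'rV[int]_n := val (repr w).

End Weights.

Definition intvec (R : realType) (n : nat) (w : 'rV[int]_n) : 'rV[R]_n :=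
  map_mx intr w.

(* Independent of the representative: see wnorm_pi. *)
Definition wnorm (R : realType) (n : nat) (w : weight n) : R :=
  enorm (intvec R (wrepr w)).

Lemma wnorm_pi (R : realType) (n : nat) (u : nzvec n) :
  wnorm R (\pi_(weight n) u)%qT = enorm (intvec R (val u)).
Proof.
have /eqmodP : (\pi_(weight n) (repr (\pi_(weight n) u)) = \pi_(weight n) u)%qT.
  by rewrite reprK.
rewrite /wnorm /wrepr => /orP[]/eqP -> //.
by rewrite /enorm; congr Num.sqrt; apply: eq_bigr => i _; rewrite !mxE mulrNz sqrrN.
Qed.

Section Cells.
Variables (R : realType) (n : nat).
Implicit Types (U e : set 'rV[R]_n) (v : 'rV[R]_n).

Definition closed_in U (X : set 'rV[R]_n) : Prop :=
  exists C : set 'rV[R]_n, closed C /\ X = C `&` U.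

(* A one-dimensional polyhedron in U: a nondegenerate interval of a straight
   line, contained in U and closed in U.  Its ends may be points of U, points
   of the boundary of U, or at infinity. *)
Definition edge_cell U e : Prop :=
  (exists (p d : 'rV[R]_n) (I : set R),
     [/\ d != 0, is_interval I, (exists s t, [/\ I s, I t & s < t])
       & e = [set p + t *: d | t in I]])
  /\ closed_in U e.

(* The zero-dimensional faces of e, i.e. its extreme points. *)
Definition endpoint e v : Prop :=
  e v /\ forall x y t, e x -> e y -> 0 < t < 1 ->
    v = (1 - t) *: x + t *: y -> x = y.

(* The length of a straight interval is the distance between its two ends; the
   supremum accounts for ends not in e, and is +oo when e is unbounded. *)
Definition elength e : \bar R :=
  ereal_sup [set (enorm (y - x))%:E | x in e & y in e].

Definition parallel e (w : weight n) : Prop :=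
  forall x y, e x -> e y -> exists t : R, y - x = t *: intvec R (wrepr w).

(* For v an endpoint of e and w parallel to e, the representative of w which
   points away from v along e. *)
Definition outward e (w : weight n) v : 'rV[int]_n :=
  if `[< exists t : R, 0 < t /\ e (v + t *: intvec R (wrepr w)) >]
  then wrepr w else - wrepr w.

Lemma outward_away U e (w : weight n) v :
  edge_cell U e -> parallel e w -> endpoint e v ->
  (exists t : R, 0 < t /\ e (v + t *: intvec R (outward e w v))) /\
  (forall t : R, 0 < t -> ~ e (v - t *: intvec R (outward e w v))).
Proof.
move=> [[p [d [I [d0 _ [s0 [t0 [Is It lt_st]]] eE]]]] _] par [ev vext].
have intvecN (u : 'rV[int]_n) : intvec R (- u) = - intvec R u.
  by apply/rowP => i; rewrite !mxE mulrNz.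
have [x ex xv] : exists2 x, e x & x != v.
  have [ev1|nv1] := eqVneq (p + s0 *: d) v; last first.
    by exists (p + s0 *: d) => //; rewrite eE; exists s0.
  exists (p + t0 *: d); first by rewrite eE; exists t0.
  rewrite -ev1 (inj_eq (addrI p)) -subr_eq0 -scalerBl scaler_eq0 negb_or d0 andbT.
  by rewrite subr_eq0 gt_eqF.
have [t xE] := par _ _ ev ex.
have {}xE : x = v + t *: intvec R (wrepr w) by rewrite -xE addrC subrK.
have ex_pos : exists t : R, 0 < t /\ e (v + t *: intvec R (outward e w v)).
  rewrite /outward; case: asboolP => // nex.
  have [t_lt0|t_gt0|t_eq0] := ltgtP t 0.
  - exists (- t); split; first by rewrite oppr_gt0.
    by rewrite intvecN scalerN scaleNr opprK -xE.
  - by case: nex; exists t; split=> //; rewrite -xE.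
  - by move: xv; rewrite xE t_eq0 scale0r addr0 eqxx.
split=> // r r_gt0 er; have [s [s_gt0 es]] := ex_pos.
set o := intvec R _ in er es.
have rs_gt0 : 0 < r + s by rewrite addr_gt0.
have rs0 : r + s != 0 by rewrite gt_eqF.
have : v - r *: o = v + s *: o.
  apply: (vext _ _ (r / (r + s))) => //.
    by rewrite divr_gt0 //= ltr_pdivrMr // mul1r ltrDl.
  rewrite !scalerDr addrACA -scalerDl subrK scale1r scalerN !scalerA -scaleNr.
  rewrite -scalerDl mulrBl mul1r opprB.
  suff -> : r / (r + s) * r - r + r / (r + s) * s = 0 by rewrite scale0r addr0.
  by rewrite addrAC -mulrDr divfK // subrr.
move=> /addrI /eqP; rewrite -scaleNr -subr_eq0 -scalerBl scaler_eq0.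
rewrite -opprD oppr_eq0 (negPf rs0) /= => /eqP o0.
have w0 : intvec R (wrepr w) = 0.
  by move: o0; rewrite /o /outward; case: ifP => // _ /eqP; rewrite intvecN oppr_eq0 => /eqP.
by move: xv; rewrite xE w0 scaler0 addr0 eqxx.
Qed.

End Cells.

Record tropical_curve (R : realType) (n : nat) (U : set 'rV[R]_n) :=
  TropicalCurve {
  tc_vertices : set 'rV[R]_n ;
  tc_edges : set (set 'rV[R]_n) ;
  (* only the values at the edges matter *)
  tc_weight : set 'rV[R]_n -> weight n ;
  tc_finite_vertices : finite_set tc_vertices ;
  tc_finite_edges : finite_set tc_edges ;
  tc_vertices_sub : tc_vertices `<=` U ;
  tc_edge_cell : forall e, tc_edges e -> edge_cell U e ;
  tc_endpoint_vertex : forall e v,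
    tc_edges e -> endpoint e v -> tc_vertices v ;
  tc_vertex_endpoint : forall e v,
    tc_edges e -> tc_vertices v -> e v -> endpoint e v ;
  tc_edges_meet : forall e e', tc_edges e -> tc_edges e' -> e <> e' ->
    e `&` e' = set0 \/
    exists v, [/\ e `&` e' = [set v], endpoint e v & endpoint e' v] ;
  (* implied by tc_edge_cell and finiteness; kept as part of the definition *)
  tc_closed : closed_in U (tc_vertices `|` \bigcup_(e in tc_edges) e) ;
  tc_valence : forall v, tc_vertices v ->
    `I_3 #<= [set e | tc_edges e /\ endpoint e v] ;
  tc_parallel : forall e, tc_edges e -> parallel e (tc_weight e) ;
  tc_balanced : forall v, tc_vertices v ->
    \sum_(e \in [set e | tc_edges e /\ endpoint e v])
      outward e (tc_weight e) v = 0
}.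

Definition edge_area (R : realType) (n : nat) (e : set 'rV[R]_n)
    (w : weight n) : \bar R :=
  (elength e * (wnorm R w)%:E)%E.

Definition tc_area (R : realType) (n : nat) (U : set 'rV[R]_n)
    (G : tropical_curve U) : \bar R :=
  (\sum_(e \in tc_edges G) edge_area e (tc_weight G e))%E.

(* Main.v *)
Require Import Defs.
From HB Require Import structures.
From mathcomp Require Import all_boot all_order all_algebra finmap.
From mathcomp Require Import all_classical all_reals all_analysis.
From mathcomp Require Import ring lra.

Set Implicit Arguments.
Unset Strict Implicit.
Unset Printing Implicit Defensive.

Import Order.TTheory GRing.Theory Num.Theory.
Import numFieldNormedType.Exports.

Local Open Scope classical_set_scope.
Local Open Scope card_scope.
Local Open Scope ring_scope.

(** By compactness it suffices to bound the vertices near a point [x] of [U].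
Integrating over the level, the area bound yields, for each coordinate [k], two
levels of [x_k], one on either side of [x], such that the edges meeting each of
them have total weight [O(A)]; these levels bound a box in [U].  At a
vertex two incident edges are not parallel, so some coordinate plane [(i, j)]
sees a nonzero, hence at least [1] in absolute value, minor of their weights.
It remains to bound, for a fixed [(i, j)], the vertices in the box with such a
minor.

Project the part of the curve in the box to that plane and prolong the edges
which leave the box.  Sweep the plane by vertical lines: the sum over
pairs of edges of the sign of their height difference times the wedge of
their weights never decreases, because two lines separate after they meet,
and it jumps by at least [1/2] at each vertex considered.  By balancing, its
total variation only involves the ends of the prolonged edges, so it is at
most quadratic in the weight through the boundary of the box. *)

(** * Pairs of segments in the plane *)

Section Planar.
Variable R : realFieldType.
Implicit Types a b c d u v x : R * R.

Definition wedge u v : R := u.1 * v.2 - u.2 * v.1.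

Definition along (p : R * R) (t : R) (w : R * R) : R * R :=
  (p.1 + t * w.1, p.2 + t * w.2).

Definition vdiff x y : R * R := (x.1 - y.1, x.2 - y.2).

(* The indicator of the abscissae of the segment [c, d], with value [1/2] at its
   ends; it vanishes on vertical segments. *)
Definition hit c d x : R := (Num.sg (d.1 - x.1) - Num.sg (c.1 - x.1)) / 2.

(** For [v.1 > 0] the sign is that of the height of [x] over the line of direction [v] through
    [c]. *)
Definition kern c d v x : R := hit c d x * Num.sg (wedge v (vdiff x c)).

(** One difference follows the ends of [[a, b]], the other those of [[c, d]]; the minus sign between
    them is there because exchanging the segments reverses their height difference. *)
Definition cross a b u c d v : R :=
  kern c d v b - kern c d v a - (kern a b u d - kern a b u c).

Lemma crossC a b u c d v : cross c d v a b u = - cross a b u c d v.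
Proof. by rewrite /cross [RHS]opprB. Qed.

Lemma wedgeC u v : wedge v u = - wedge u v.
Proof. rewrite /wedge; ring. Qed.

Lemma sg_cases (z : R) : [\/ z < 0 /\ Num.sg z = -1, z = 0 /\ Num.sg z = 0
  | 0 < z /\ Num.sg z = 1].
Proof.
case: (ltgtP z 0) => h.
- by constructor 1; rewrite ltr0_sg.
- by constructor 3; rewrite gtr0_sg.
- by constructor 2; rewrite h sgr0.
Qed.

Lemma sgr_homo (y z : R) : y <= z -> Num.sg y <= Num.sg z.
Proof.
by move=> ?; case: (sg_cases y) => -[? ->]; case: (sg_cases z) => -[? ->]; lra.
Qed.

Lemma hit_ge0 c d x : c.1 <= d.1 -> 0 <= hit c d x.
Proof.
by move=> cd; rewrite /hit divr_ge0 // subr_ge0 sgr_homo // lerD2r.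
Qed.

Lemma hit_le1 c d x : hit c d x <= 1.
Proof.
rewrite /hit.
by case: (sg_cases (d.1 - x.1)) => -[_ ->]; case: (sg_cases (c.1 - x.1)) => -[_ ->]; lra.
Qed.

Section Pair.
Variables (a c u v : R * R) (tau sigma : R).
Hypotheses (tau_gt0 : 0 < tau) (sigma_gt0 : 0 < sigma).
Let b := along a tau u.
Let d := along c sigma v.

(* A positive multiple of the height of [a + R u] above [c + R v] at the abscissa
   [s]: [cross] is the change of its sign over the common abscissae. *)
Let D (s : R) := v.1 * (u.1 * a.2 + u.2 * (s - a.1))
  - u.1 * (v.1 * c.2 + v.2 * (s - c.1)).

Lemma sg_pM (k z : R) : 0 < k -> Num.sg (k * z) = Num.sg z.
Proof. by move=> k0; rewrite sgrM gtr0_sg // mul1r. Qed.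

Lemma cross_nonvertical : 0 < u.1 -> 0 < v.1 ->
  cross a b u c d v =
    hit c d b * Num.sg (D b.1) - hit c d a * Num.sg (D a.1)
    + hit a b d * Num.sg (D d.1) - hit a b c * Num.sg (D c.1).
Proof.
move=> u1 v1; rewrite /cross /kern.
have -> : Num.sg (wedge v (vdiff b c)) = Num.sg (D b.1).
  rewrite -(sg_pM _ u1); congr Num.sg; rewrite /D /wedge /vdiff /b /along /=; ring.
have -> : Num.sg (wedge v (vdiff a c)) = Num.sg (D a.1).
  rewrite -(sg_pM _ u1); congr Num.sg; rewrite /D /wedge /vdiff /=; ring.
have -> : Num.sg (wedge u (vdiff d a)) = - Num.sg (D d.1).
  rewrite -sgrN -(sg_pM _ v1); congr Num.sg.
  rewrite /D /wedge /vdiff /d /along /=; ring.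
have -> : Num.sg (wedge u (vdiff c a)) = - Num.sg (D c.1).
  rewrite -sgrN -(sg_pM _ v1); congr Num.sg; rewrite /D /wedge /vdiff /=; ring.
ring.
Qed.

Let D_diff s t : D t - D s = wedge v u * (t - s).
Proof. rewrite /D /wedge; ring. Qed.

(** [D] is affine of slope [wedge v u], so its sign never decreases, and [hit] reduces the four
    terms to the change of this sign over the common abscissae, if any. *)
Lemma cross_nonvertical_ge0 : 0 < u.1 -> 0 < v.1 -> 0 < wedge v u ->
  0 <= cross a b u c d v.
Proof.
move=> u1 v1 vu; rewrite cross_nonvertical // /hit.
have mono s t : s <= t -> Num.sg (D s) <= Num.sg (D t).
  move=> st; apply: sgr_homo; rewrite -subr_ge0 D_diff.
  by apply: mulr_ge0; [exact: ltW|rewrite subr_ge0].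
have ab : a.1 < b.1 by rewrite /b /along /= ltrDl mulr_gt0.
have cd : c.1 < d.1 by rewrite /d /along /= ltrDl mulr_gt0.
move: a.1 b.1 c.1 d.1 ab cd => a1 b1 c1 d1 ab cd.
have sgab : Num.sg (D a1) <= Num.sg (D b1) by apply: mono; lra.
have sgcd : Num.sg (D c1) <= Num.sg (D d1) by apply: mono; lra.
have lt_sg (s t : R) : s < t -> (Num.sg (t - s) = 1) * (Num.sg (s - t) = -1).
  by move=> st; rewrite gtr0_sg ?ltr0_sg ?subr_gt0 ?subr_lt0.
(* The intervals of abscissae overlap, touch or are disjoint. At equal ends the two values [1/2] of
   [hit] add up, or cancel if the intervals only touch. *)
case: (ltgtP a1 d1) => [ad|ad|ad].
- case: (ltgtP c1 b1) => [cb|cb|cb].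
  + have sgad : Num.sg (D a1) <= Num.sg (D d1) by apply: mono; lra.
    have sgcb : Num.sg (D c1) <= Num.sg (D b1) by apply: mono; lra.
    rewrite !(lt_sg _ _ ad) !(lt_sg _ _ cb).
    case: (ltgtP a1 c1) => [ac|ac|ac]; case: (ltgtP b1 d1) => [bd|bd|bd];
     rewrite ?(lt_sg _ _ ac) ?(lt_sg _ _ bd) ?ac ?bd ?subrr ?sgr0; subst; lra.
  + have ac := lt_trans ab cb; have bd := lt_trans cb cd.
    rewrite !(lt_sg _ _ ad) !(lt_sg _ _ cb) !(lt_sg _ _ ac) !(lt_sg _ _ bd); lra.
  + subst; rewrite !(lt_sg _ _ ad) !(lt_sg _ _ ab) !(lt_sg _ _ cd) !subrr !sgr0; lra.
- have ca := lt_trans cd ad; have db := lt_trans ad ab.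
  have cb := lt_trans ca ab.
  rewrite !(lt_sg _ _ ad) !(lt_sg _ _ cb) !(lt_sg _ _ ca) !(lt_sg _ _ db); lra.
- subst; have cb := lt_trans cd ab.
  rewrite !(lt_sg _ _ ab) !(lt_sg _ _ cd) !(lt_sg _ _ cb) !subrr !sgr0; lra.
Qed.

(** The sign is 0 at the common left end and 1 to its right; the values of [hit] at the two right
    ends add up to 1, whichever segment is longer. *)
Lemma cross_left : 0 < u.1 -> 0 < v.1 -> 0 < wedge v u -> a = c ->
  1 <= cross a b u c d v.
Proof.
move=> u1 v1 vu ac; rewrite cross_nonvertical // /hit.
have ab : a.1 < b.1 by rewrite /b /along /= ltrDl mulr_gt0.
have cd : c.1 < d.1 by rewrite /d /along /= ltrDl mulr_gt0.
have Dc : D c.1 = 0 by rewrite /D ac; ring.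
have Da : D a.1 = 0 by rewrite ac Dc.
have pos s : c.1 < s -> Num.sg (D s) = 1.
  move=> cs; have := D_diff c.1 s; rewrite Dc subr0 => ->.
  by apply: gtr0_sg; apply: mulr_gt0; last rewrite subr_gt0.
rewrite Da Dc (pos b.1) -?ac // (pos d.1) // !ac sgr0.
have cb : c.1 < b.1 by rewrite -ac.
rewrite [Num.sg (c.1 - b.1)]ltr0_sg ?subr_lt0 // [Num.sg (c.1 - d.1)]ltr0_sg ?subr_lt0 //.
by rewrite -[b.1 - d.1]opprB sgrN; lra.
Qed.

Lemma cross_right : 0 < u.1 -> 0 < v.1 -> 0 < wedge v u -> b = d ->
  1 <= cross a b u c d v.
Proof.
move=> u1 v1 vu bd; rewrite cross_nonvertical // /hit.
have ab : a.1 < b.1 by rewrite /b /along /= ltrDl mulr_gt0.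
have cd : c.1 < d.1 by rewrite /d /along /= ltrDl mulr_gt0.
have Dd : D d.1 = 0.
  rewrite /D; have -> : v.2 * (d.1 - c.1) = v.1 * (d.2 - c.2).
    by rewrite /d /along /=; ring.
  rewrite -bd; have -> : u.2 * (b.1 - a.1) = u.1 * (b.2 - a.2).
    by rewrite /b /along /=; ring.
  ring.
have neg s : s < d.1 -> Num.sg (D s) = -1.
  move=> cs; have := D_diff d.1 s; rewrite Dd subr0 => ->.
  by apply: ltr0_sg; rewrite pmulr_rlt0 // subr_lt0.
have ad : a.1 < d.1 by rewrite -bd.
rewrite bd Dd (neg a.1) // (neg c.1) // sgr0.
rewrite [Num.sg (d.1 - a.1)]gtr0_sg ?subr_gt0 // [Num.sg (d.1 - c.1)]gtr0_sg ?subr_gt0 //.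
by rewrite -[a.1 - c.1]opprB sgrN; lra.
Qed.

Lemma cross_vertical : u.1 = 0 -> 0 < v.1 ->
  cross a b u c d v =
    hit c d a * (Num.sg (wedge v (vdiff a c) + tau * wedge v u)
                 - Num.sg (wedge v (vdiff a c))).
Proof.
move=> u1 v1; have ba : b.1 = a.1 by rewrite /b /along /= u1; ring.
rewrite /cross /kern /hit ba !subrr !mul0r !subr0 -mulrBr; congr (_ * (Num.sg _ - _)).
rewrite /wedge /vdiff /b /along /=; ring.
Qed.

(** Going along the vertical segment moves the argument of the sign by [tau * wedge v u]. *)
Lemma cross_vertical_ge0 : u.1 = 0 -> 0 < v.1 ->
  0 <= wedge v u * cross a b u c d v.
Proof.
move=> u1 v1; rewrite cross_vertical // mulrCA mulr_ge0 //.
  by apply: hit_ge0; rewrite /d /along /= lerDl mulr_ge0 // ltW.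
have [vu|vu] := leP 0 (wedge v u).
  by rewrite mulr_ge0 // subr_ge0 sgr_homo // lerDl mulr_ge0 // ltW.
rewrite mulr_le0 ?(ltW vu) // subr_le0 sgr_homo // gerDl mulr_ge0_le0 //; exact: ltW.
Qed.

(** At a common end [hit] is [1/2] and one of the two signs is 0, so the product is
    [|wedge v u| / 2]. *)
Lemma cross_vertical_corner (s s' : bool) : u.1 = 0 -> 0 < v.1 ->
  1 <= `|wedge v u| -> (if s then b else a) = (if s' then d else c) ->
  2^-1 <= wedge v u * cross a b u c d v.
Proof.
move=> u1 v1 vu eq_end; rewrite cross_vertical //.
have cd : c.1 < d.1 by rewrite /d /along /= ltrDl mulr_gt0.
have ba : b.1 = a.1 by rewrite /b /along /= u1; ring.
have a1 : a.1 = (if s' then d else c).1 by rewrite -eq_end; case: (s).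
have -> : hit c d a = 2^-1.
  rewrite /hit a1; case: (s'); rewrite subrr sgr0.
    by rewrite ltr0_sg ?subr_lt0 //; lra.
  by rewrite gtr0_sg ?subr_gt0 //; lra.
have end0 : wedge v (vdiff (if s' then d else c) c) = 0.
  by case: (s'); rewrite /wedge /vdiff /d /along /=; ring.
have -> : Num.sg (wedge v (vdiff a c) + tau * wedge v u)
          - Num.sg (wedge v (vdiff a c)) = Num.sg (wedge v u).
  rewrite -eq_end in end0; case: (s) end0 => end0; last first.
    by rewrite end0 add0r sgr0 subr0 sg_pM.
  have -> : wedge v (vdiff a c) = - (tau * wedge v u).
    rewrite -[LHS]subr0 -end0 /wedge /vdiff /b /along /=; ring.
  by rewrite addNr sgr0 sgrN sg_pM // sub0r opprK.
rewrite mulrCA (mulrC (wedge v u)) -normrEsg; lra.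
Qed.

End Pair.

(** The contribution of a pair to the sweep. Both factors are antisymmetric, so the segments may be
    exchanged to make [wedge v u] positive when it is nonzero. *)
Definition pairing a b u c d v : R := wedge v u * cross a b u c d v.

Lemma pairingC a b u c d v : pairing a b u c d v = pairing c d v a b u.
Proof. by rewrite /pairing wedgeC crossC mulrNN. Qed.

Lemma pairing_ge0 a c u v tau sigma : 0 < tau -> 0 < sigma ->
  0 <= u.1 -> 0 <= v.1 ->
  0 <= pairing a (along a tau u) u c (along c sigma v) v.
Proof.
move=> tau0 sigma0.
rewrite le_eqVlt => /orP[/eqP/esym u1|u1];
rewrite le_eqVlt => /orP[/eqP/esym v1|v1].
- by rewrite /pairing /wedge u1 v1 mul0r mulr0 subrr mul0r.
- exact: cross_vertical_ge0.
- by rewrite pairingC; apply: cross_vertical_ge0.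
- wlog vu : a c u v tau sigma tau0 sigma0 u1 v1 / 0 < wedge v u.
    move=> H; case: (ltgtP (wedge v u) 0) => [vu|vu|vu].
    + by rewrite pairingC H // wedgeC oppr_gt0.
    + exact: H.
    + by rewrite /pairing vu mul0r.
  by rewrite /pairing mulr_ge0 ?cross_nonvertical_ge0 // ltW.
Qed.

(** The last condition excludes non-vertical segments on opposite sides of their common end: the
    height difference vanishes at their only common abscissa, so their pairing is 0. *)
Lemma pairing_corner a c u v tau sigma (s s' : bool) :
  0 < tau -> 0 < sigma -> 0 <= u.1 -> 0 <= v.1 -> 1 <= `|wedge v u| ->
  (if s then along a tau u else a) = (if s' then along c sigma v else c) ->
  [\/ u.1 = 0, v.1 = 0 | s = s'] ->
  2^-1 <= pairing a (along a tau u) u c (along c sigma v) v.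
Proof.
move=> tau0 sigma0.
rewrite le_eqVlt => /orP[/eqP/esym u1|u1];
rewrite le_eqVlt => /orP[/eqP/esym v1|v1] vu ends side.
- by move: vu; rewrite /wedge u1 v1 mul0r mulr0 subrr normr0 ler10.
- exact: (cross_vertical_corner _ _ _ _ _ ends).
- rewrite pairingC; apply: (cross_vertical_corner _ _ _ _ _ (esym ends)) => //.
  by rewrite wedgeC normrN.
- have {side} ss : s = s'.
    case: side => [u0|v0|//]; first by rewrite u0 ltxx in u1.
    by rewrite v0 ltxx in v1.
  subst s'.
  wlog vu0 : a c u v tau sigma tau0 sigma0 u1 v1 vu ends / 0 < wedge v u.
    move=> H; case: (ltgtP (wedge v u) 0) => [vu0|vu0|vu0].
    + by rewrite pairingC H // wedgeC ?normrN ?oppr_gt0.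
    + exact: H.
    + by move: vu; rewrite vu0 normr0 ler10.
  have h : 1 <= cross a (along a tau u) u c (along c sigma v) v.
    by case: s ends => ends; [exact: cross_right|exact: cross_left].
  rewrite gtr0_norm // in vu.
  have : 1 * 1 <= pairing a (along a tau u) u c (along c sigma v) v.
    by rewrite /pairing ler_pM.
  by rewrite mulr1; apply: le_trans; lra.
Qed.

End Planar.

(** * Balanced families of segments in the plane *)

Definition side (R : pzRingType) (s : bool) : R := if s then 1 else -1.

Lemma norm_side (R : numDomainType) s : `|side R s| = 1.
Proof. by case: s; rewrite /side ?normrN normr1. Qed.

Section PlanarFamily.
Variables (R : realFieldType) (I : finType).
(** The segment [e] goes from [X e false] to [X e true], from left to right unless [(w e).1 = 0];
    [bnd e s] marks the ends at which no balancing is required. *)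
Variables (w : I -> R * R) (X : I -> bool -> R * R) (tau : I -> R).
Variables (bnd : I -> bool -> bool) (alpha beta : R) (N : I -> R).
Local Notation side := (side R).

Hypothesis w1_ge0 : forall e, 0 <= (w e).1.
Hypothesis tau_gt0 : forall e, 0 < tau e.
Hypothesis X_along : forall e, X e true = along (X e false) (tau e) (w e).
(** Balancing in weak form: with [F] the indicator of a point, and all [z], the weights of the ends
    at this point outside [bnd], signed by [side], add up to zero. *)
Hypothesis balanced : forall (F : R * R -> R) (z : R * R),
  \sum_e \sum_(s | ~~ bnd e s) side s * F (X e s) * wedge z (w e) = 0.
Hypothesis wN1 : forall e, `|(w e).1| <= N e.
Hypothesis wN2 : forall e, `|(w e).2| <= N e.
Hypothesis X_interior : forall e s, ~~ bnd e s -> alpha < (X e s).1 < beta.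
Hypothesis X_nonvertical : forall e s, bnd e s -> 0 < (w e).1 ->
  (X e s).1 = if s then beta else alpha.
(* A vertical boundary segment ends above, or below, all non-vertical lines. *)
Hypothesis X_vertical : forall e s, bnd e s -> (w e).1 = 0 -> (w e).2 != 0 ->
  forall f, 0 < (w f).1 ->
  Num.sg (wedge (w f) (vdiff (X e s) (X f false))) = side s * Num.sg (w e).2.

Let W := \sum_e \sum_(s | bnd e s) N e.
Let K f x := kern (X f false) (X f true) (w f) x.
Let H f x := hit (X f false) (X f true) x.

Let N_ge0 e : 0 <= N e. Proof. exact: le_trans (wN1 e). Qed.

Lemma wedge_le e f : `|wedge (w f) (w e)| <= 2 * (N f * N e).
Proof.
have -> : 2 * (N f * N e) = N f * N e + N f * N e by ring.
by rewrite (le_trans (ler_normB _ _)) // lerD // normrM ler_pM.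
Qed.

Let X1_le f : (X f false).1 <= (X f true).1.
Proof. by rewrite X_along /= lerDl mulr_ge0 // ltW. Qed.

Let H_le1 f x : `|H f x| <= 1.
Proof. by rewrite ger0_norm ?hit_le1 // hit_ge0 // X1_le. Qed.

Lemma sum_boundary (F : R * R -> R) z :
  \sum_e \sum_s side s * F (X e s) * wedge z (w e) =
  \sum_e \sum_(s | bnd e s) side s * F (X e s) * wedge z (w e).
Proof.
under eq_bigr => e _ do rewrite (bigID (bnd e)) /=.
by rewrite big_split /= balanced addr0.
Qed.

Let kern_le f x : `|K f x| <= `|H f x|.
Proof.
rewrite /K /kern normrM ler_piMr // normr_sg.
by case: (_ != 0); rewrite ?lexx ?ler01.
Qed.

Let sum_boundary_le (G : I -> R) e :
  (forall f, (forall s, ~~ bnd f s) -> G f = 0) ->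
  (forall f, `|G f| <= 1) ->
  `|\sum_f G f * wedge (w f) (w e)| <= 2 * (N e * W).
Proof.
move=> G0 G1; rewrite (le_trans (ler_norm_sum _ _ _)) // /W !mulr_sumr.
apply: ler_sum => f _.
(* Only segments with a boundary end contribute, and the bound [N f] of such a segment already
   occurs in [W]. *)
have [/existsP[s bfs]|] := boolP [exists s, bnd f s]; last first.
  rewrite negb_exists => /forallP bf.
  rewrite (G0 f bf) mul0r normr0 big_pred0 ?mulr0 // => s; exact/negbTE.
rewrite (bigD1 s) //= normrM mulrDr mulrDr [N e * N f]mulrC.
rewrite -[leLHS]addr0 lerD //.
  by rewrite -[leRHS]mul1r ler_pM // wedge_le.
by rewrite mulr_ge0 // mulr_ge0 ?N_ge0 // sumr_ge0 // => *; apply: N_ge0.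
Qed.

(** A non-vertical boundary end lies over [alpha] or [beta], where [hit] vanishes for segments
    without boundary end. A vertical one lies above, or below, all non-vertical lines, so [kern] is
    a constant sign times [hit]. *)
Lemma boundary_term_le e s : bnd e s ->
  `|\sum_f K f (X e s) * wedge (w f) (w e)| <= 2 * (N e * W).
Proof.
move=> bes; have := w1_ge0 e; rewrite le_eqVlt => /orP[/eqP/esym w1|w1].
  have [w2|w2] := eqVneq (w e).2 0.
    rewrite big1 ?normr0 => [|f _]; last by rewrite /wedge w1 w2 !mulr0 subrr mulr0.
    rewrite mulr_ge0 // mulr_ge0 ?N_ge0 // sumr_ge0 // => f _.
    by apply: sumr_ge0 => *; apply: N_ge0.
  have KH f : K f (X e s) = side s * Num.sg (w e).2 * H f (X e s).
    have := w1_ge0 f; rewrite le_eqVlt => /orP[/eqP/esym f1|f1].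
      by rewrite /H /K /kern /hit X_along /= f1 mulr0 addr0 subrr !mul0r mulr0.
    by rewrite /K /kern (X_vertical bes) // mulrC.
  (* [hit] is itself a difference between the two ends of [f], so balancing leaves only its boundary
     ends, collected in [G]. *)
  pose F (y : R * R) := Num.sg (y.1 - (X e s).1) / 2.
  have HF f : H f (X e s) = \sum_s' side s' * F (X f s').
    by rewrite big_bool /= /H /hit /F mul1r mulN1r -mulrBl.
  pose G f := \sum_(s' | bnd f s') side s' * F (X f s').
  have -> : \sum_f K f (X e s) * wedge (w f) (w e) =
      side s * Num.sg (w e).2 * \sum_f G f * wedge (w f) (w e).
    transitivity (side s * Num.sg (w e).2 * \sum_f H f (X e s) * wedge (w f) (w e)).
      by rewrite mulr_sumr; apply: eq_bigr => f _; rewrite KH [RHS]mulrA.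
    congr (_ * _); apply: oppr_inj; rewrite -!sumrN.
    transitivity (\sum_f \sum_s' side s' * F (X f s') * wedge (w e) (w f)).
      by apply: eq_bigr => f _; rewrite HF -mulrN -wedgeC mulr_suml.
    rewrite sum_boundary; apply: eq_bigr => f _.
    by rewrite -mulr_suml -mulrN -wedgeC.
  rewrite normrM normrM norm_side mul1r normr_sg w2 mul1r.
  apply: sum_boundary_le => [f bf|f].
    by rewrite /G big_pred0 // => s'; apply/negbTE.
  have Fle y : `|F y| <= 2^-1.
    rewrite /F normrM [ `|2^-1|]ger0_norm ?invr_ge0 // ler_piMl ?invr_ge0 //.
    by rewrite normr_sg; case: (_ != 0); rewrite ?lexx ?ler01.
  rewrite /G (le_trans (ler_norm_sum _ _ _)) //.
  rewrite (@le_trans _ _ (\sum_(s' : bool) 2^-1)) //; last first.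
    by rewrite big_bool /=; lra.
  rewrite big_mkcond /=; apply: ler_sum => s' _; case: ifP => _.
    by rewrite normrM norm_side mul1r.
  by rewrite invr_ge0.
apply: sum_boundary_le => [f bf|f]; last exact: le_trans (kern_le _ _) (H_le1 _ _).
apply/eqP; rewrite -normr_le0 (le_trans (kern_le _ _)) // normr_le0; apply/eqP.
have /andP[Af0 fB0] := X_interior (bf false).
have /andP[Af1 fB1] := X_interior (bf true).
rewrite /H /hit (X_nonvertical bes w1); case: (s).
  by rewrite !ltr0_sg ?subr_lt0 //; lra.
by rewrite !gtr0_sg ?subr_gt0 //; lra.
Qed.

Definition family_pairing e f : R :=
  pairing (X e false) (X e true) (w e) (X f false) (X f true) (w f).

Lemma family_pairing_ge0 e f : 0 <= family_pairing e f.
Proof. by rewrite /family_pairing !X_along pairing_ge0. Qed.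

(** Summation by parts: each half of [cross] is a difference between the ends of one segment;
    summing over this segment, balancing cancels all but the boundary ends. *)
Lemma sum_pairing_le : \sum_e \sum_f family_pairing e f <= 4 * W ^+ 2.
Proof.
pose g e f := wedge (w f) (w e) * (K f (X e true) - K f (X e false)).
(* Exchanging the two segments turns one half of [cross] into the other. *)
have -> : \sum_e \sum_f family_pairing e f = 2 * \sum_f \sum_e g e f.
  have -> : 2 * \sum_f \sum_e g e f = \sum_e \sum_f g e f + \sum_e \sum_f g f e.
    by rewrite [X in X + _]exchange_big /=; ring.
  rewrite -big_split; apply: eq_bigr => e _; rewrite -big_split; apply: eq_bigr => f _.
  rewrite /= /family_pairing /pairing /cross /g (wedgeC (w f) (w e)) /K; ring.
have -> : \sum_f \sum_e g e f =
    \sum_e \sum_(s | bnd e s) side s * \sum_f K f (X e s) * wedge (w f) (w e).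
  have -> : \sum_f \sum_e g e f =
      \sum_f \sum_e \sum_(s | bnd e s) side s * K f (X e s) * wedge (w f) (w e).
    apply: eq_bigr => f _; rewrite -sum_boundary; apply: eq_bigr => e _.
    by rewrite /g big_bool /=; ring.
  rewrite exchange_big; apply: eq_bigr => e _; rewrite exchange_big /=.
  by apply: eq_bigr => s _; rewrite mulr_sumr; apply: eq_bigr => f _; rewrite [RHS]mulrA.
have -> : 4 * W ^+ 2 = 2 * \sum_e \sum_(s | bnd e s) 2 * (N e * W).
  under [in RHS]eq_bigr => e _ do rewrite -mulr_sumr -mulr_suml.
  by rewrite -mulr_sumr -mulr_suml -/W; ring.
rewrite ler_pM2l //; apply: ler_sum => e _; apply: ler_sum => s bes.
apply: le_trans (ler_norm _) _; rewrite normrM norm_side mul1r.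
exact: boundary_term_le.
Qed.

(** Distinct vertices give distinct pairs, each contributing at least [1/2] to a sum of nonnegative
    terms that is at most [4 * W ^+ 2]. *)
Lemma corners_le (V : finType) (g : V -> I * I) : injective g ->
  (forall v, 2^-1 <= family_pairing (g v).1 (g v).2) ->
  #|V|%:R <= 8 * W ^+ 2.
Proof.
move=> g_inj g_corner.
have le1 : \sum_(v : V) 2^-1 <= \sum_e \sum_f family_pairing e f.
  rewrite pair_bigA /=.
  apply: (@le_trans _ _ (\sum_(q in (g @: [set: V])%SET) family_pairing q.1 q.2)).
    rewrite big_imset /= => [|? ? _ _]; last exact: g_inj.
    rewrite [leRHS](eq_bigl predT) => [|v]; last by rewrite inE.
    by apply: ler_sum => v _; apply: g_corner.
  rewrite [leRHS](bigID (mem (g @: [set: V])%SET)) /= lerDl sumr_ge0 // => q _.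
  exact: family_pairing_ge0.
have := le_trans le1 sum_pairing_le; rewrite sumr_const -mulr_natr; lra.
Qed.

End PlanarFamily.

(** * Prolongation of the segments leaving the strip *)

Section PlanarCount.
Variables (R : realFieldType) (I : finType).
Variables (p w : I -> R * R) (t : I -> bool -> R).
Variables (bnd : I -> bool -> bool) (alpha beta : R) (N : I -> R).
Local Notation side := (side R).
Let X e s := along (p e) (t e s) (w e).

Hypothesis w1_ge0 : forall e, 0 <= (w e).1.
Hypothesis t_lt : forall e, t e false < t e true.
Hypothesis X_range : forall e s, alpha <= (X e s).1 <= beta.

Lemma vertical_far e s (r : R) : (w e).2 != 0 -> exists2 r',
  side s * r <= side s * r' & forall f : I, 0 < (w f).1 ->
  Num.sg (wedge (w f) (vdiff (p e) (p f)) + r' * ((w f).1 * (w e).2)) =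
  side s * Num.sg (w e).2.
Proof.
(* [C f] is the height of [p e] over the line of [f]. In [m], the first term reaches beyond [r], the
   second dominates every [C f] and the 1 makes this strict. *)
move=> w2; pose C f := wedge (w f) (vdiff (p e) (p f)) / (w f).1.
pose m := `|r| + (\sum_f `|C f|) / `|(w e).2| + 1.
have sum0 : 0 <= (\sum_f `|C f|) / `|(w e).2| by rewrite divr_ge0 ?sumr_ge0.
exists (side s * m) => [|f f1].
  rewrite mulrA (_ : side s * side s = 1) ?mul1r; last first.
    by case: (s); rewrite /= ?mulrNN mulr1.
  rewrite /m; case: (s) => /=; rewrite ?mul1r ?mulN1r;
    have := ler_norm r; have := ler_norm (- r); rewrite normrN; lra.
have -> : wedge (w f) (vdiff (p e) (p f)) = (w f).1 * C f.
  by rewrite /C mulrC divfK // gt_eqF.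
rewrite [_ * (_ * (w e).2)]mulrCA -mulrDr sg_pM //.
have Cm : `|C f| < m * `|(w e).2|.
  have : `|C f| <= \sum_f `|C f|.
    by rewrite (bigD1 f) //= lerDl sumr_ge0.
  move/le_lt_trans; apply; rewrite /m !mulrDl divfK ?normr_eq0 // mul1r.
  have : 0 < `|(w e).2| by rewrite normr_gt0.
  have : 0 <= `|r| * `|(w e).2| by rewrite mulr_ge0.
  lra.
have := ler_norm (C f); have := ler_norm (- C f); rewrite normrN => h1 h2.
case: (sg_cases (w e).2) => -[w20 ->].
- rewrite (ltr0_norm w20) in Cm; case: (s); rewrite /= ?mul1r ?mulN1r ?mulNr.
    by rewrite ltr0_sg //; lra.
  by rewrite gtr0_sg ?opprK //; lra.
- by rewrite w20 eqxx in w2.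
- rewrite (gtr0_norm w20) in Cm; case: (s); rewrite /= ?mul1r ?mulN1r ?mulNr.
    by rewrite gtr0_sg //; lra.
  by rewrite ltr0_sg //; lra.
Qed.

(** A boundary end is pushed outward to the side of the strip or, if vertical, far enough to clear
    all lines; an end of zero projected weight stays in place. *)
Lemma extend_end e s : exists r, [/\ side s * t e s <= side s * r,
  (~~ bnd e s -> r = t e s),
  (bnd e s -> 0 < (w e).1 -> (p e).1 + r * (w e).1 = if s then beta else alpha)
  & (bnd e s -> (w e).1 = 0 -> (w e).2 != 0 -> forall f, 0 < (w f).1 ->
     Num.sg (wedge (w f) (vdiff (p e) (p f)) + r * ((w f).1 * (w e).2)) =
     side s * Num.sg (w e).2)].
Proof.
have [bes|bes] := boolP (bnd e s); last by exists (t e s); split.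
have := w1_ge0 e; rewrite le_eqVlt => /orP[/eqP/esym w1|w1].
  have [w2|w2] := eqVneq (w e).2 0.
    by exists (t e s); split=> //; rewrite w1 ltxx.
  have [r rt rV] := vertical_far s (t e s) w2.
  by exists r; split=> //; rewrite w1 ltxx.
exists (((if s then beta else alpha) - (p e).1) / (w e).1); split=> //.
- have /andP[] := X_range e s; rewrite /X /along /=; case: (s) => /= h1 h2.
    by rewrite !mul1r ler_pdivlMr //; lra.
  by rewrite !mulN1r lerN2 ler_pdivrMr //; lra.
- by move=> _ _; rewrite divfK ?gt_eqF // addrC subrK.
- by move=> _ w10; rewrite w10 ltxx in w1.
Qed.

Hypothesis balanced : forall (F : R * R -> R) (z : R * R),
  \sum_e \sum_(s | ~~ bnd e s) side s * F (X e s) * wedge z (w e) = 0.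
Hypothesis wN1 : forall e, `|(w e).1| <= N e.
Hypothesis wN2 : forall e, `|(w e).2| <= N e.
Hypothesis X_interior : forall e s, ~~ bnd e s -> alpha < (X e s).1 < beta.

(** Prolongation fixes the ends outside [bnd], hence preserves balancing and corners; the crossings
    it may create only add nonnegative terms. *)
Lemma planar_count (V : finType) (g : V -> I * I) : injective g ->
  (forall v, exists s s', let: (e, f) := g v in
    [/\ ~~ bnd e s, ~~ bnd f s', X e s = X f s', 1 <= `|wedge (w f) (w e)|
      & [\/ (w e).1 = 0, (w f).1 = 0 | s = s']]) ->
  #|V|%:R <= 8 * (\sum_e \sum_(s | bnd e s) N e) ^+ 2.
Proof.
move=> g_inj g_corner.
have [r rP] := fin_all_exists (fun q : I * bool => extend_end q.1 q.2).
pose Y e s := along (p e) (r (e, s)) (w e).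
have YX e s : ~~ bnd e s -> Y e s = X e s.
  by move=> bes; rewrite /Y; case: (rP (e, s)) => /= _ -> .
have Y_along e : Y e true = along (Y e false) (r (e, true) - r (e, false)) (w e).
  by rewrite /Y /along /=; congr (_, _); ring.
have r_lt e : 0 < r (e, true) - r (e, false).
  case: (rP (e, true)) => /= + _ _ _; case: (rP (e, false)) => /= + _ _ _.
  rewrite !mul1r !mulN1r lerN2; have := t_lt e; lra.
apply: (@corners_le _ _ w Y (fun e => r (e, true) - r (e, false)) bnd alpha beta N) => //.
- move=> F z; rewrite -[RHS](balanced F z); apply: eq_bigr => e _.
  by apply: eq_bigr => s bes; rewrite YX.
- by move=> e s bes; rewrite YX //; apply: X_interior.
- by move=> e s bes; case: (rP (e, s)) => /= _ _ + _; apply.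
- move=> e s bes w1 w2 f f1; case: (rP (e, s)) => /= _ _ _ /(_ bes w1 w2 f f1) <-.
  by congr Num.sg; rewrite /wedge /vdiff /Y /along /= w1; ring.
- exact: g_inj.
- move=> v; have [s [s']] := g_corner v; case: (g v) => e f /= [be bf Xs ef sd].
  rewrite /family_pairing !Y_along; apply: (@pairing_corner _ _ _ _ _ _ _ s s') => //.
  by rewrite -!Y_along -(YX e s) // -(YX f s') // in Xs *; case: (s) (s') Xs => [] [].
Qed.

End PlanarCount.

(** * Slices and corners *)

Lemma count_ltn (T : eqType) (P Q : pred T) (r : seq T) z :
  subpred Q P -> z \in r -> P z -> ~~ Q z -> (count Q r < count P r)%N.
Proof.
move=> QP + Pz Qz; elim: r => //= x r IHr; rewrite inE => /orP[/eqP <-|zr].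
  by rewrite Pz (negPf Qz) add0n add1n ltnS sub_count.
rewrite -addnS leq_add ?IHr //; case: (boolP (Q x)) => // /QP ->; exact: leqnn.
Qed.

(** A mean value argument: the total weight at level [s] is a step function, whose integral from [p]
    to [q] is at most the right-hand side. *)
Lemma exists_slice (R : realFieldType) (I : finType) (c lo hi : I -> R) (p q : R) :
  p < q -> (forall e, 0 <= c e) -> (forall e, lo e <= hi e) ->
  exists2 s, p < s < q &
    (q - p) * \sum_(e | lo e <= s <= hi e) c e <= \sum_e c e * (hi e - lo e).
Proof.
move=> pq c_ge0 lohi.
(* Lengths are clipped to [[p, q]], which makes the bound additive under subdivision, as the
   induction needs. *)
pose len e p q := Num.max 0 (Num.min (hi e) q - Num.max (lo e) p).
pose S s := \sum_(e | lo e <= s <= hi e) c e.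
suff [s spq Ss] : exists2 s, p < s < q & (q - p) * S s <= \sum_e c e * len e p q.
  exists s => //; apply: le_trans Ss _; apply: ler_sum => e _.
  apply: ler_wpM2l => //; rewrite /len ge_max subr_ge0 lohi /=.
  by apply: lerB; [rewrite ge_min lexx|rewrite le_max lexx].
pose bp : seq R := codom lo ++ codom hi.
(* Induction on the number of breakpoints strictly between [p] and [q]. *)
have [n] := ubnP (count (fun z => p < z < q) bp).
elim: n p q pq => // n IHn p q pq; rewrite ltnS => le_n.
have [/hasP[z zbp /andP[pz zq]]|] := boolP (has (fun z => p < z < q) bp).
  have count_lt (a b : R) : p <= a -> b <= q -> ~~ (a < z < b) ->
      (count (fun y => (a < y < b)%R) bp < n)%N.
    move=> pa bq nz; apply: leq_trans le_n.
    apply: (count_ltn (z := z)) => //; last by rewrite /= pz.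
    move=> y /= /andP[ay yb].
    by rewrite (le_lt_trans pa ay) (lt_le_trans yb bq).
  have nz1 : ~~ (p < z < z) by rewrite ltxx andbF.
  have nz2 : ~~ (z < z < q) by rewrite ltxx.
  have [s1 /andP[ps1 s1z] S1] := IHn p z pz (count_lt p z (lexx p) (ltW zq) nz1).
  have [s2 /andP[zs2 s2q] S2] := IHn z q zq (count_lt z q (ltW pz) (lexx q) nz2).
  have lenD : \sum_e c e * len e p q =
      \sum_e c e * len e p z + \sum_e c e * len e z q.
    rewrite -big_split; apply: eq_bigr => e _ /=; rewrite -mulrDr; congr (_ * _).
    have := lohi e; rewrite /len; move: (lo e) (hi e) => l h lh.
    case: (leP h q) => ?; case: (leP h z) => ?; case: (leP l p) => ?;
      case: (leP l z) => ?; do ! case: (leP 0) => ?; lra.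
  (* Of the levels found on either side of [z], the one with the smaller sum serves for the whole
     interval. *)
  have [S12|S21] := leP (S s1) (S s2).
    exists s1; first by rewrite ps1 (lt_trans s1z).
    by rewrite lenD; nra.
  exists s2; first by rewrite s2q (lt_trans pz).
  by rewrite lenD; nra.
(* Without breakpoints, an interval containing the midpoint covers [[p, q]]. *)
rewrite -all_predC => /allP nbp.
exists ((p + q) / 2); first by apply/andP; split; lra.
rewrite /S mulr_sumr big_mkcond /=; apply: ler_sum => e _.
case: ifP => [/andP[les esh]|_]; last by rewrite mulr_ge0 // /len le_max lexx.
rewrite mulrC ler_wpM2l //.
have /= := nbp (lo e); rewrite mem_cat codom_f => /(_ isT).
have /= := nbp (hi e); rewrite mem_cat codom_f orbT => /(_ isT).
rewrite !negb_and -!leNgt /len => /orP[] ? /orP[] ?; try lra.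
rewrite le_max; apply/orP; right.
by case: (leP (hi e)) => ?; case: (leP (lo e)) => ?; lra.
Qed.

Lemma sum_eq0_opposite (R : realDomainType) (T : eqType) (r : seq T) (h : T -> R) f :
  \sum_(g <- r) h g = 0 -> f \in r -> h f != 0 ->
  exists2 g, g \in r & h g * h f < 0.
Proof.
move=> sum0 fr hf.
have [/hasP[g gr gf]|] := boolP (has (fun g => h g * h f < 0) r); first by exists g.
rewrite -all_predC => /allP ge0.
have : \sum_(g <- r) h g * h f = 0 by rewrite -mulr_suml sum0 mul0r.
move/eqP; rewrite big_seq_cond psumr_eq0 => [/allP/(_ f fr)|g /andP[/ge0]]; last first.
  by rewrite /= -leNgt.
by rewrite fr /= mulf_eq0 orbb (negPf hf).
Qed.

(** Provides two non-parallel edges at a vertex which, unless one is vertical, leave it on the same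
    side: such a pair contributes to the sweep. *)
Lemma exists_corner (R : realFieldType) (T : eqType) (r : seq T) (o : T -> R * R) e f :
  \sum_(g <- r) (o g).1 = 0 -> \sum_(g <- r) (o g).2 = 0 ->
  e \in r -> f \in r -> wedge (o e) (o f) != 0 ->
  exists e' f', [/\ e' \in r, f' \in r, wedge (o e') (o f') != 0
    & [\/ (o e').1 = 0, (o f').1 = 0 | 0 < (o e').1 * (o f').1]].
Proof.
move=> sum1 sum2 er fr ef.
have [e1|e1] := eqVneq (o e).1 0; first by exists e, f; split=> //; constructor 1.
have [f1|f1] := eqVneq (o f).1 0; first by exists e, f; split=> //; constructor 2.
case: (ltgtP ((o e).1 * (o f).1) 0) => ef1; last first.
- by move/eqP: ef1; rewrite mulf_eq0 (negPf e1) (negPf f1).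
- by exists e, f; split=> //; constructor 3.
(* Here [e] and [f] leave on opposite sides. Balancing gives [g] across the line of [e] from [f]; it
   goes with [e] or, failing that, with [f]. *)
have sumW : \sum_(g <- r) wedge (o e) (o g) = 0.
  by rewrite /wedge big_split /= sumrN -!mulr_sumr sum1 sum2 !mulr0 subrr.
have [g gr gf] := sum_eq0_opposite sumW fr ef.
have eg : wedge (o e) (o g) != 0.
  by apply: contraTneq gf => ->; rewrite mul0r ltxx.
have [g1|g1] := eqVneq (o g).1 0; first by exists e, g; split=> //; constructor 2.
have [eg1|eg1] := ltP 0 ((o e).1 * (o g).1).
  by exists e, g; split=> //; constructor 3.
have fg1 : 0 < (o f).1 * (o g).1.
  have : 0 <= ((o f).1 * (o g).1) * (o e).1 ^+ 2.
    rewrite (_ : _ * _ = ((o e).1 * (o f).1) * ((o e).1 * (o g).1)); last by ring.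
    by rewrite mulr_le0 // ltW.
  by rewrite pmulr_lge0 ?exprn_even_gt0 // le_eqVlt eq_sym mulf_eq0 (negPf f1) (negPf g1).
exists f, g; split=> //; last by constructor 3.
(* If [f] and [g] were parallel, this identity would put them on the same side of the line of
   [e]. *)
have key : (o e).1 * wedge (o f) (o g) =
  (o f).1 * wedge (o e) (o g) - (o g).1 * wedge (o e) (o f) by rewrite /wedge; ring.
apply: contraTneq gf => fg0; rewrite fg0 mulr0 in key; rewrite -leNgt.
have -> : 0 <= wedge (o e) (o g) * wedge (o e) (o f) =
    (0 <= ((o f).1 * (o g).1) * (wedge (o e) (o g) * wedge (o e) (o f))).
  by rewrite [RHS]pmulr_rge0.
rewrite mulrACA (_ : (o f).1 * wedge (o e) (o g) = (o g).1 * wedge (o e) (o f)); last lra.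
by rewrite -expr2 sqr_ge0.
Qed.

(** * Edges of a tropical curve in a box *)

Lemma row_neq0 (R : zmodType) n (x : 'rV[R]_n) : x != 0 -> exists k, x ord0 k != 0.
Proof.
move=> x0; apply/existsP; apply: contraNT x0; rewrite negb_exists => /forallP xk.
by apply/eqP/rowP => k; rewrite mxE; apply/eqP; have := xk k; rewrite negbK.
Qed.

Lemma intvecN (R : realType) n (z : 'rV[int]_n) : intvec R (- z) = - intvec R z.
Proof. by apply/rowP => k; rewrite !mxE mulrNz. Qed.

Lemma intvec_eq0 (R : realType) n (z : 'rV[int]_n) : (intvec R z == 0) = (z == 0).
Proof.
apply/eqP/eqP => [/rowP z0|->]; last by apply/rowP => k; rewrite !mxE.
by apply/rowP => k; have /eqP := z0 k; rewrite !mxE intr_eq0 => /eqP.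
Qed.

Lemma wrepr_neq0 n (w : weight n) : wrepr w != 0.
Proof. exact: valP (repr w). Qed.

Section Box.
Variables (R : realType) (n : nat).
Implicit Types (al be : 'I_n -> R) (x d p : 'rV[R]_n).

Definition cbox al be : set 'rV[R]_n :=
  [set x | forall k, al k <= x ord0 k <= be k].

Definition obox al be : set 'rV[R]_n :=
  [set x | forall k, al k < x ord0 k < be k].

Lemma obox_cbox al be : obox al be `<=` cbox al be.
Proof. by move=> x xB k; have /andP[? ?] := xB k; rewrite !ltW. Qed.

Lemma cbox_closed al be : closed (cbox al be).
Proof.
have -> : cbox al be = \bigcap_k (fun x : 'rV[R]_n => x ord0 k) @^-1` `[al k, be k].
  by apply/seteqP; split=> x xB k; [move=> _ /=; rewrite in_itv /=|have := xB k I];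
    rewrite ?xB //= in_itv.
apply: closed_bigI => k _; apply: preimage_closed; last exact: itv_closed.
by move=> x _; apply: coord_continuous.
Qed.

Lemma obox_open al be : open (obox al be).
Proof.
rewrite openE => x xB; exists (fun _ k => [set` `]al k, be k[]).
  move=> i k /=; apply: open_nbhs_nbhs; split; first exact: interval_open.
  by rewrite /= in_itv /= (ord1 i); apply: xB.
by move=> y yB k; have := yB ord0 k; rewrite /= in_itv.
Qed.

Lemma line_continuous p d : continuous (fun t : R => p + t *: d).
Proof. by move=> t; apply: cvgD; [exact: cvg_cst|exact: scalel_continuous]. Qed.

Lemma obox_line al be p d (t : R) : obox al be p -> 0 < t ->
  exists2 s, 0 < s < t & obox al be (p + s *: d).
Proof.
move=> pB t0.
have : nbhs (0 : R) ((fun s : R => p + s *: d) @^-1` obox al be).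
  apply: line_continuous; apply: open_nbhs_nbhs; split; first exact: obox_open.
  by rewrite scale0r addr0.
case/nbhs_ballP => r /= r0 rB.
have s0 : 0 < Num.min r t / 2 by rewrite divr_gt0 // lt_min r0.
have sr : Num.min r t / 2 < r.
  by case: (leP r t) => ?; lra.
have st : Num.min r t / 2 < t.
  by case: (leP r t) => ?; lra.
exists (Num.min r t / 2); first by rewrite s0.
apply: rB; rewrite /ball /= sub0r normrN ger0_norm //; exact: ltW.
Qed.

End Box.

Section Edge.
Variables (R : realType) (n : nat) (U e : set 'rV[R]_n).
Hypothesis eU : edge_cell U e.
Implicit Types (p d v x y : 'rV[R]_n).

Lemma edge_between p d (r s t : R) : r <= s <= t ->
  e (p + r *: d) -> e (p + t *: d) -> e (p + s *: d).
Proof.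
case: eU => -[q [c [J [c0 J_itv _ ->]]]] _ /andP[rs st] [a Ja aE] [b Jb bE].
have [rt|rt] := eqVneq r t.
  have -> : s = r by apply/le_anti; rewrite rs rt st.
  by exists a.
have rt_lt : r < t by rewrite lt_neqAle rt (le_trans rs st).
pose l := (s - r) / (t - r).
have tr : 0 < t - r by rewrite subr_gt0.
have l01 : 0 <= l <= 1.
  rewrite /l divr_ge0 ?subr_ge0 ?(ltW rt_lt) //=.
  by rewrite ler_pdivrMr // mul1r lerD2r.
have sE : s = r + l * (t - r) by rewrite /l divfK ?gt_eqF // addrC subrK.
exists (a + l * (b - a)).
  have /andP[l0 l1] := l01.
  have [ab|ba] := leP a b.
    by apply: (J_itv a b) => //; apply/andP; split; nra.
  by apply: (J_itv b a) => //; apply/andP; split; nra.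
have -> : q + (a + l * (b - a)) *: c = (1 - l) *: (q + a *: c) + l *: (q + b *: c).
  by apply/rowP => k; rewrite !mxE; ring.
by rewrite aE bE sE; apply/rowP => k; rewrite !mxE; ring.
Qed.

Lemma edge_nontrivial p : exists2 x, e x & x != p.
Proof.
case: eU => -[q [c [J [c0 _ [s [t [Js Jt st]]] ->]]]] _.
have [ps|ps] := eqVneq (q + s *: c) p; last by exists (q + s *: c) => //; exists s.
exists (q + t *: c); first by exists t.
rewrite -ps (inj_eq (addrI q)) -subr_eq0 -scalerBl scaler_eq0 negb_or c0 andbT.
by rewrite subr_eq0 gt_eqF.
Qed.

Variables (al be : 'I_n -> R).
Hypothesis BU : cbox al be `<=` U.
Local Notation B := (cbox al be).
Local Notation B0 := (obox al be).

(** Take for [t] the supremum of the parameters of points in both edge and closed box. If it is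
    reached in the open box, convexity excludes any later point of the edge. *)
Lemma edge_exit p d : d != 0 -> e p -> B0 p -> exists t : R,
  [/\ 0 <= t, e (p + t *: d), B (p + t *: d),
      (forall s, t < s -> B0 (p + s *: d) -> ~ e (p + s *: d))
    & (B0 (p + t *: d) -> forall s, t < s -> ~ e (p + s *: d))].
Proof.
move=> d0 ep pB.
pose J : set R := [set t | e (p + t *: d) /\ B (p + t *: d)].
have J0 : J 0 by rewrite /J /= scale0r addr0; split=> //; apply: obox_cbox.
have [k dk] := row_neq0 d0.
have J_ub : has_ubound J.
  exists ((be k - al k) / `|d ord0 k|) => t [_ /(_ k)]; rewrite !mxE => /andP[h1 h2].
  rewrite ler_pdivlMr ?normr_gt0 //.
  have /andP[h3 h4] := pB k.
  apply: le_trans (_ : `|t * d ord0 k| <= _).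
    by rewrite normrM ler_wpM2r // ler_norm.
  by rewrite ler_norml; apply/andP; split; lra.
(* In [U] the edge agrees with a closed set, and the closed box lies in [U]. *)
have J_closed : closed J.
  case: eU => _ [C [C_closed eC]].
  have -> : J = (fun t : R => p + t *: d) @^-1` (C `&` B).
    apply/seteqP; split=> t; rewrite /J /= eC => -[].
      by case=> Ct _ Bt.
    by move=> Ct Bt; split=> //; split=> //; apply: BU.
  apply: preimage_closed; first by move=> t _; apply: line_continuous.
  by apply: closedI => //; apply: cbox_closed.
have [es Bs] : J (sup J).
  by apply: J_closed; apply: closure_sup => //; exists 0.
have s_ub t : J t -> t <= sup J by move=> Jt; apply: ub_le_sup.
exists (sup J); split=> //.
- exact: s_ub.
- move=> t st Bt et; have : t <= sup J by apply: s_ub; split=> //; apply: obox_cbox.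
  by rewrite leNgt st.
- move=> Bs0 t st et.
  have st0 : 0 < t - sup J by rewrite subr_gt0.
  have [r /andP[r0 rt] Br] := obox_line d Bs0 st0.
  rewrite -addrA -scalerDl in Br.
  have : sup J + r <= sup J.
    apply: s_ub; split; last exact: obox_cbox.
    apply: (@edge_between _ _ (sup J) _ t) => //.
    by apply/andP; split; lra.
  by rewrite gerDl leNgt r0.
Qed.

Variables (wt : weight n) (z : 'rV[int]_n).
Hypothesis e_wt : parallel e wt.
Hypothesis zE : z = wrepr wt \/ z = - wrepr wt.
Let d := intvec R z.

Lemma edge_dir_neq0 : d != 0.
Proof. by rewrite /d intvec_eq0; case: zE => ->; rewrite ?oppr_eq0 wrepr_neq0. Qed.

Lemma edge_param x y : e x -> e y -> exists t : R, y = x + t *: d.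
Proof.
move=> ex ey; have [t yx] := e_wt ex ey.
rewrite /d; case: zE => ->; first by exists t; rewrite -yx addrC subrK.
by exists (- t); rewrite intvecN scaleNr scalerN opprK -yx addrC subrK.
Qed.

(** The whole edge lies on one side of [v] along [d], so a proper convex combination equal to [v]
    has both its points at [v]. *)
Lemma edge_last_endpoint v (s : bool) :
  (forall t : R, 0 < t -> ~ e (v + t *: (side R s *: d))) -> e v ->
  endpoint e v /\ outward e wt v = if s then - z else z.
Proof.
move=> v_last ev.
have v_end : endpoint e v.
  split=> // x y t ex ey /andP[t0 t1].
  have [a xE] := edge_param ev ex; have [b yE] := edge_param ev ey.
  have sgn_le c : e (v + c *: d) -> side R s * c <= 0.
    move=> ec; rewrite leNgt; apply/negP => c0; apply: (v_last _ c0).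
    rewrite scalerA mulrAC (_ : side R s * side R s = 1) ?mul1r //.
    by case: (s); rewrite /= ?mulrNN mulr1.
  rewrite xE in ex; rewrite yE in ey; move/sgn_le: ex; move/sgn_le: ey => hb ha.
  rewrite xE yE => /eqP; rewrite -subr_eq0.
  have -> : v - ((1 - t) *: (v + a *: d) + t *: (v + b *: d)) =
      - ((1 - t) * a + t * b) *: d.
    by apply/rowP => k; rewrite !mxE; ring.
  rewrite scaler_eq0 (negPf edge_dir_neq0) orbF oppr_eq0 => /eqP ab.
  suff [-> ->] : a = 0 /\ b = 0 by [].
  move: ha hb; case: (s); rewrite /= ?mul1r ?mulN1r ?oppr_le0 => ha hb;
    split; nra.
split=> //.
have [[t [t0 et]] _] := outward_away eU e_wt v_end.
have : outward e wt v = z \/ outward e wt v = - z.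
  by rewrite /outward; case: ifP => _; case: zE => ->; rewrite ?opprK; auto.
case: (s) v_last => v_last [] oE //; rewrite oE in et; exfalso; apply: (v_last _ t0).
  by rewrite /= scale1r.
by rewrite /= scaleN1r -intvecN.
Qed.

(** The two ends are the exit points in the directions [d] and [- d]; where an exit point is in the
    open box, the edge itself stops. *)
Lemma edge_in_box : (exists2 p, e p & B0 p) -> exists (p : 'rV[R]_n) (t : bool -> R),
  [/\ t false < t true, (forall s, e (p + t s *: d)), (forall s, B (p + t s *: d)),
    (forall s, B0 (p + t s *: d) -> endpoint e (p + t s *: d) /\
       outward e wt (p + t s *: d) = if s then - z else z)
    & (forall v, endpoint e v -> B0 v -> exists s, v = p + t s *: d)].
Proof.
case=> p ep pB.
have [t1 [t1_ge0 et1 Bt1 out1 last1]] := edge_exit edge_dir_neq0 ep pB.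
have dN0 : - d != 0 by rewrite oppr_eq0 edge_dir_neq0.
have [t0 [t0_ge0 et0 Bt0 out0 last0]] := edge_exit dN0 ep pB.
rewrite scalerN -scaleNr in et0 Bt0 last0.
(* If both parameters were 0, the edge would reduce to [p]. *)
have t01 : - t0 < t1.
  rewrite lt_neqAle; apply/andP; split; last by lra.
  apply/eqP => t01; have [t1E t0E] : t1 = 0 /\ t0 = 0 by split; lra.
  have [x ex xp] := edge_nontrivial p; have [t xE] := edge_param ep ex.
  rewrite t1E scale0r addr0 in last1; rewrite t0E oppr0 scale0r addr0 in last0.
  case: (ltgtP t 0) => t_0.
  - by apply: (last0 pB (- t)); rewrite ?oppr_gt0 // scalerN scaleNr opprK -xE.
  - by apply: (last1 pB t); rewrite // -xE.
  - by rewrite xE t_0 scale0r addr0 eqxx in xp.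
exists p, (fun s => if s then t1 else - t0); split=> //.
- by case.
- by case.
- case=> Bs; [apply: (@edge_last_endpoint _ true)|apply: (@edge_last_endpoint _ false)]
    => // t t_gt0.
    rewrite /= scale1r -addrA -scalerDl; apply: last1 => //; lra.
  rewrite /= scaleN1r -addrA scalerN -scaleNr -scalerDl => et.
  apply: (last0 Bs (t0 + t)); first by lra.
  by rewrite scalerN -scaleNr opprD.
- move=> v [ev v_ext] Bv; have [t vE] := edge_param ep ev.
  have t_le : t <= t1.
    by rewrite leNgt; apply/negP => /out1; rewrite -vE; apply.
  have t_ge : - t0 <= t.
    rewrite leNgt; apply/negP => tt.
    by apply: (out0 (- t)); rewrite ?scalerN ?scaleNr ?opprK -?vE //; lra.
  have [tt1|tt1] := eqVneq t t1; first by exists true; rewrite vE tt1.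
  have [tt0|tt0] := eqVneq t (- t0); first by exists false; rewrite vE tt0.
  (* Strictly between the exit points, [v] would not be extreme. *)
  exfalso; pose l := (t + t0) / (t1 + t0).
  have t10 : 0 < t1 + t0 by lra.
  have l01 : 0 < l < 1.
    have lt0 : - t0 < t by rewrite lt_neqAle eq_sym tt0.
    have lt1 : t < t1 by rewrite lt_neqAle tt1.
    by rewrite /l divr_gt0 ?ltr_pdivrMr ?mul1r //=; lra.
  have /= := v_ext _ _ l et0 et1 l01.
  have lE : t = - t0 + l * (t1 + t0) by rewrite /l divfK ?gt_eqF //; ring.
  have -> : (1 - l) *: (p + (- t0) *: d) + l *: (p + t1 *: d) = v.
    by rewrite vE [in RHS]lE; apply/rowP => k; rewrite !mxE; ring.
  move=> /(_ erefl) /addrI /eqP; rewrite -subr_eq0 -scalerBl scaler_eq0.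
  by rewrite (negPf edge_dir_neq0) orbF subr_eq0 lt_eqF.
Qed.

End Edge.

(** * Vertices of a tropical curve in a box *)

Lemma perm_fset_set_sub (T : choiceType) (D : set T) (Q : T -> Prop) : finite_set D ->
  perm_eq (fset_set [set x | D x /\ Q x]) [seq x <- fset_set D | `[< Q x >]].
Proof.
move=> finD; have finDQ : finite_set [set x | D x /\ Q x].
  by apply: sub_finite_set finD => x [].
apply: uniq_perm; rewrite ?filter_uniq ?fset_uniq // => x.
rewrite mem_filter !in_fset_set //; apply/idP/idP.
  by rewrite inE => -[Dx Qx]; apply/andP; split; [exact/asboolP|rewrite inE].
by case/andP => /asboolP Qx; rewrite !inE.
Qed.

Lemma le_enorm (R : realType) n (x : 'rV[R]_n) k : `|x ord0 k| <= enorm x.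
Proof.
rewrite -sqrtr_sqr /enorm ler_wsqrtr // (bigD1 k) //= lerDl sumr_ge0 // => i _.
exact: sqr_ge0.
Qed.

Lemma enormN (R : realType) n (x : 'rV[R]_n) : enorm (- x) = enorm x.
Proof. by congr Num.sqrt; apply: eq_bigr => i _; rewrite mxE sqrrN. Qed.

Lemma le_wnorm (R : realType) n (w : weight n) (z : 'rV[int]_n) k :
  z = wrepr w \/ z = - wrepr w -> `|intvec R z ord0 k| <= wnorm R w.
Proof.
move=> zE; rewrite (le_trans (le_enorm _ _)) // /wnorm.
by case: zE => ->; rewrite // intvecN enormN.
Qed.

Definition proj (R : realType) n (i j : 'I_n) (x : 'rV[R]_n) : R * R :=
  (x ord0 i, x ord0 j).

Lemma minors_eq0_parallel (R : realType) n (x y : 'rV[R]_n) : x != 0 ->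
  (forall i j, wedge (proj i j x) (proj i j y) = 0) -> exists c, y = c *: x.
Proof.
move=> x0 xy.
have [k xk] := row_neq0 x0.
exists (y ord0 k / x ord0 k); apply/rowP => l; rewrite mxE.
have := xy k l; rewrite /wedge /= => /eqP; rewrite subr_eq0 => /eqP kl.
by apply: (mulfI xk); rewrite kl; field.
Qed.

Lemma intr_norm_ge1 (R : realType) (m : int) : m != 0 -> 1 <= `|m%:~R : R|.
Proof.
by move=> m0; rewrite -intr_norm ler1z -gtz0_ge1 normr_gt0.
Qed.

Lemma wedge_intvec (R : realType) n (i j : 'I_n) (y z : 'rV[int]_n) :
  wedge (proj i j (intvec R y)) (proj i j (intvec R z)) =
  (y ord0 i * z ord0 j - y ord0 j * z ord0 i)%:~R.
Proof. by rewrite /wedge /proj /= !mxE intrB !intrM. Qed.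

Section Curve.
Variables (R : realType) (n : nat) (U : set 'rV[R]_n) (G : tropical_curve U).
Local Notation E := (tc_edges G).
Local Notation V := (tc_vertices G).
Local Notation wt := (tc_weight G).
Implicit Types (e f : set 'rV[R]_n) (v : 'rV[R]_n).

Definition incident v : set (set 'rV[R]_n) := [set e | E e /\ endpoint e v].

Definition outdir e v : 'rV[R]_n := intvec R (outward e (wt e) v).

Lemma incident_finite v : finite_set (incident v).
Proof. by apply: sub_finite_set (tc_finite_edges G) => e []. Qed.

Lemma mem_incident v e : e \in fset_set (incident v) <-> incident v e.
Proof. by rewrite in_fset_set ?inE //; apply: incident_finite. Qed.

Lemma outward_cases e v : outward e (wt e) v = wrepr (wt e) \/
  outward e (wt e) v = - wrepr (wt e).
Proof. by rewrite /outward; case: ifP; auto. Qed.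

Lemma outdir_neq0 e v : outdir e v != 0.
Proof. by apply: edge_dir_neq0; apply: outward_cases. Qed.

Lemma sum_outdir v k : V v ->
  \sum_(e <- fset_set (incident v)) outdir e v ord0 k = 0.
Proof.
move=> Vv; have := tc_balanced Vv; rewrite fsbig_finite; last exact: incident_finite.
move=> /(congr1 (fun x : 'rV[int]_n => (x ord0 k)%:~R : R)).
rewrite summxE mxE rmorph_sum mulr0z /= => h; rewrite -[RHS]h.
by apply: eq_bigr => e _; rewrite mxE.
Qed.

Lemma outdir_ray e v : incident v e -> exists2 t : R, 0 < t &
  forall s, 0 <= s <= t -> e (v + s *: outdir e v).
Proof.
case=> Ee ve; have eU := tc_edge_cell Ee.
have [[t [t0 et]] _] := outward_away eU (tc_parallel Ee) ve.
exists t => // s st; apply: (@edge_between _ _ _ _ eU _ _ 0 _ t) => //.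
by rewrite scale0r addr0; case: ve.
Qed.

Lemma meet_unique e f v v' : E e -> E f -> e <> f ->
  e v -> f v -> e v' -> f v' -> v = v'.
Proof.
move=> Ee Ef ef ev fv ev' fv'; case: (tc_edges_meet Ee Ef ef) => [|[x [efx _ _]]].
  by move/seteqP => [/(_ v) +]; case.
have -> : v = x by have : (e `&` f) v by []; rewrite efx.
by have : (e `&` f) v' by []; rewrite efx.
Qed.

(** Otherwise both edges contain a short segment issued from [v], whereas distinct edges share at
    most one point. *)
Lemma outdir_not_positive e f v (c : R) : incident v e -> incident v f ->
  e <> f -> outdir f v = c *: outdir e v -> c <= 0.
Proof.
move=> ve vf ef oE; rewrite leNgt; apply/negP => c0.
have [t t0 et] := outdir_ray ve; have [s s0 fs] := outdir_ray vf.
pose r := Num.min t (s * c).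
have sc0 : 0 < s * c by rewrite mulr_gt0.
have r0 : 0 < r by rewrite lt_min t0.
have : v + r *: outdir e v = v.
  apply: (@meet_unique e f); [by case: ve|by case: vf|by []| | | |].
  - by apply: et; rewrite ltW //= ge_min lexx.
  - have -> : r *: outdir e v = (r / c) *: outdir f v.
      by rewrite oE scalerA divfK ?gt_eqF.
    by apply: fs; rewrite divr_ge0 ?(ltW r0) ?(ltW c0) //= ler_pdivrMr // ge_min lexx orbT.
  - by case: ve => _ [].
  - by case: vf => _ [].
move/eqP; rewrite -subr_eq0 addrC addKr scaler_eq0 (negPf (outdir_neq0 e v)) orbF.
by rewrite gt_eqF.
Qed.

Definition has_minor i j v : Prop := exists e f, [/\ incident v e, incident v f
  & wedge (proj i j (outdir e v)) (proj i j (outdir f v)) != 0].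

(** If all minors vanish, the edges at [v] are parallel, and of any three two point the same way,
    which is impossible. *)
Lemma vertex_has_minor v : V v -> exists i j, has_minor i j v.
Proof.
move=> Vv; apply: contrapT => no_minor.
have minor0 e f i j : incident v e -> incident v f ->
    wedge (proj i j (outdir e v)) (proj i j (outdir f v)) = 0.
  move=> ve vf; apply: contrapT => /eqP ef; apply: no_minor.
  by exists i, j, e, f.
have := leq_card_fset_set (incident_finite v) (tc_valence Vv).
have : forall e, e \in enum_fset (fset_set (incident v)) <-> incident v e.
  exact: mem_incident.
have := fset_uniq (fset_set (incident v)).
case: (enum_fset _) => [|e1 [|e2 [|e3 r]]] //= uniq_r mem_r _.
have [v1 v2 v3] : [/\ incident v e1, incident v e2 & incident v e3].
  by split; apply/mem_r; rewrite !inE eqxx ?orbT.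
have [e12 e13 e23] : [/\ e1 <> e2, e1 <> e3 & e2 <> e3].
  by split=> h; move: uniq_r; rewrite h !in_cons eqxx ?orbT ?andbF.
have [c c2] := minors_eq0_parallel (outdir_neq0 e1 v) (fun i j => minor0 _ _ i j v1 v2).
have [d d3] := minors_eq0_parallel (outdir_neq0 e1 v) (fun i j => minor0 _ _ i j v1 v3).
have c_le := outdir_not_positive v1 v2 e12 c2.
have d_le := outdir_not_positive v1 v3 e13 d3.
have c0 : c != 0.
  by have := outdir_neq0 e2 v; rewrite c2 scaler_eq0 negb_or => /andP[].
have d0 : d != 0.
  by have := outdir_neq0 e3 v; rewrite d3 scaler_eq0 negb_or => /andP[].
have : outdir e3 v = (d / c) *: outdir e2 v by rewrite c2 scalerA divfK.
move/(outdir_not_positive v2 v3 e23); rewrite leNgt => /negP; apply.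
by rewrite -mulrNN -invrN divr_gt0 // oppr_gt0 lt_neqAle ?c0 ?d0.
Qed.

Variables (al be : 'I_n -> R) (M : R).
Hypothesis BU : cbox al be `<=` U.
Local Notation B := (cbox al be).
Local Notation B0 := (obox al be).

Definition flux k (s : R) : R :=
  \sum_(e <- fset_set E | `[< exists2 x, e x & x ord0 k = s >]) wnorm R (wt e).

Hypothesis flux_al : forall k, flux k (al k) <= M.
Hypothesis flux_be : forall k, flux k (be k) <= M.

Let A := [set e | E e /\ exists2 x, e x & B0 x].

Let A_finite : finite_set A.
Proof. by apply: sub_finite_set (tc_finite_edges G) => e []. Qed.

Let in_A (e : fset_set A) : A (fsval e).
Proof. by have := fsvalP e; rewrite in_fset_set ?inE //; apply: A_finite. Qed.

(** * Projection of the curve to a coordinate plane *)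

Section Projection.
Variables i j : 'I_n.

(** The sign is chosen so that the projected edge does not go leftward. *)
Definition orient e : 'rV[int]_n :=
  if 0 <= wrepr (wt e) ord0 i then wrepr (wt e) else - wrepr (wt e).

Lemma orient_cases e : orient e = wrepr (wt e) \/ orient e = - wrepr (wt e).
Proof. by rewrite /orient; case: ifP; auto. Qed.

Lemma orient_ge0 e : 0 <= intvec R (orient e) ord0 i.
Proof.
rewrite mxE ler0z /orient; case: ifPn => //.
by rewrite -ltNge mxE oppr_ge0; apply: ltW.
Qed.

Let d (e : fset_set A) := intvec R (orient (fsval e)).
Let w (e : fset_set A) := proj i j (d e).

Variables (p : fset_set A -> 'rV[R]_n) (t : fset_set A -> bool -> R).
Let X (e : fset_set A) s := p e + t e s *: d e.

Hypothesis t_lt : forall (e : fset_set A), t e false < t e true.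
Hypothesis eX : forall (e : fset_set A) s, fsval e (X e s).
Hypothesis BX : forall (e : fset_set A) s, B (X e s).
Hypothesis X_endpoint : forall (e : fset_set A) s, B0 (X e s) -> endpoint (fsval e) (X e s) /\
  outward (fsval e) (wt (fsval e)) (X e s) =
  if s then - orient (fsval e) else orient (fsval e).
Hypothesis endpoint_X : forall (e : fset_set A) v,
  endpoint (fsval e) v -> B0 v -> exists s, v = X e s.

Let bnd (e : fset_set A) s := ~~ `[< B0 (X e s) >].

Lemma X_proj (e : fset_set A) s : proj i j (X e s) = along (proj i j (p e)) (t e s) (w e).
Proof. by rewrite /proj /along /= !mxE. Qed.

Lemma X_inj (e : fset_set A) : injective (X e).
Proof.
move=> s s' /addrI /eqP; rewrite -subr_eq0 -scalerBl scaler_eq0 subr_eq0.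
rewrite (negPf (edge_dir_neq0 R (orient_cases _))) orbF => /eqP.
by have := t_lt e; case: s s' => [] [] // + h; rewrite h ltxx.
Qed.

Lemma side_dir (e : fset_set A) s : B0 (X e s) -> side R s *: d e = - outdir (fsval e) (X e s).
Proof.
move=> /X_endpoint[_ oE]; rewrite /outdir oE; case: (s) => /=.
  by rewrite scale1r intvecN opprK.
by rewrite scaleN1r.
Qed.

(** [side R s *: d e] is minus the outward direction, so grouping the ends by vertex leaves the
    balancing condition at each vertex in the open box. *)
Lemma projected_balance (F : R * R -> R) (z : R * R) :
  \sum_(e : fset_set A) \sum_(s | ~~ bnd e s)
    side R s * F (proj i j (X e s)) * wedge z (w e) = 0.
Proof.
pose VB := fset_set (V `&` B0).
have finVB : finite_set (V `&` B0) by apply: finite_setIl; apply: tc_finite_vertices.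
pose c e v := wedge z (proj i j (outdir e v)).
have vertex_term (e : fset_set A) :
    \sum_(s | ~~ bnd e s) side R s * F (proj i j (X e s)) * wedge z (w e) =
    \sum_(v <- VB) (if `[< endpoint (fsval e) v >]
      then - F (proj i j v) * c (fsval e) v else 0).
  transitivity (\sum_(s | ~~ bnd e s) \sum_(v <- VB | v == X e s)
      - F (proj i j v) * c (fsval e) v).
    apply: eq_bigr => s; rewrite /bnd negbK => /asboolP Bs.
    have XV : X e s \in VB.
      rewrite in_fset_set // inE; split=> //.
      have [Ae _] := in_A e; apply: (tc_endpoint_vertex Ae).
      by have [] := X_endpoint Bs.
    rewrite -big_filter filter_pred1_uniq ?fset_uniq // big_seq1 /c.
    have h k : outdir (fsval e) (X e s) ord0 k = - (side R s * d e ord0 k).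
      move/rowP/(_ k): (side_dir Bs); rewrite mxE [RHS]mxE => ->.
      by rewrite opprK.
    by rewrite /wedge /proj /= !h; ring.
  under eq_bigr do rewrite big_mkcond.
  rewrite exchange_big /= big_seq [RHS]big_seq; apply: eq_bigr => v.
  rewrite in_fset_set // inE => -[Vv Bv].
  rewrite -big_mkcondr /=; case: asboolP => [ev|nev].
    have [s vE] := endpoint_X ev Bv.
    rewrite (big_pred1 s) // => s' /=; rewrite /bnd negbK vE.
    apply/andP/eqP => [[_ /eqP/X_inj ->]//|->]; split=> //.
    by apply/asboolP; rewrite -vE.
  rewrite big_pred0 // => s; apply/negP => /andP[]; rewrite /bnd negbK => /asboolP Bs.
  by move/eqP => vE; apply: nev; rewrite vE; have [] := X_endpoint Bs.
under eq_bigr do rewrite vertex_term.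
rewrite exchange_big /= big_seq big1 // => v; rewrite in_fset_set // inE => -[Vv Bv].
rewrite -big_mkcond /= -mulr_sumr (_ : \sum_(_ | _) _ = 0) ?mulr0 //.
(* An edge with endpoint [v] meets the open box there, so [A] contains every edge at [v]. *)
have -> : \sum_(e : fset_set A | `[< endpoint (fsval e) v >]) c (fsval e) v =
    \sum_(e <- fset_set (incident v)) c e v.
  rewrite -(big_seq_fsetE _ (fset_set A) (fun e => `[< endpoint e v >]) (fun e => c e v)) /=.
  rewrite -big_filter -(perm_big _ (perm_fset_set_sub _ A_finite)) /=.
  congr (\sum_(_ <- fset_set _) _); apply/seteqP; split=> e.
    by case=> -[].
  by case=> Ee ev; split=> //; split=> //; exists v => //; case: ev.
by rewrite /c /wedge /= sumrB -!mulr_sumr !sum_outdir // !mulr0 subrr.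
Qed.

(** A boundary end lies on one of the [2n] faces of the box, and its edge counts in the flux through
    the hyperplane of that face; with two ends per edge this gives [2 * 2n * M]. *)
Lemma boundary_flux :
  \sum_(e : fset_set A) \sum_(s | bnd e s) wnorm R (wt (fsval e)) <= 4 * n%:R * M.
Proof.
pose N e := wnorm R (wt e).
have N0 e : 0 <= N e by exact: sqrtr_ge0.
pose H e k (x : R) := if `[< exists2 y, e y & y ord0 k = x >] then N e else 0.
have H0 e k x : 0 <= H e k x by rewrite /H; case: ifP.
have H_le k x : \sum_(e : fset_set A) H (fsval e) k x <= flux k x.
  rewrite -(big_seq_fsetE _ (fset_set A) predT (fun e => H e k x)) /=.
  rewrite (perm_big _ (perm_fset_set_sub _ (tc_finite_edges G))) big_filter /=.
  have -> : flux k x = \sum_(e <- fset_set E) H e k x by rewrite /flux big_mkcond.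
  by rewrite [leLHS]big_mkcond; apply: ler_sum => e _; case: ifP.
apply: (@le_trans _ _ (\sum_(e : fset_set A)
    \sum_(s : bool) \sum_k (H (fsval e) k (al k) + H (fsval e) k (be k)))).
  apply: ler_sum => e _; rewrite big_mkcond /=; apply: ler_sum => s _.
  have sum_ge0 : 0 <= \sum_k (H (fsval e) k (al k) + H (fsval e) k (be k)).
    by apply: sumr_ge0 => k _; rewrite addr_ge0.
  case: ifPn => // /asboolP nB.
  have [k kE] : exists k, X e s ord0 k = al k \/ X e s ord0 k = be k.
    apply: contrapT => nk; apply: nB => k; have /andP[h1 h2] := BX e s k.
    rewrite !lt_neqAle h1 h2 !andbT; apply/andP; split; apply/eqP => h;
      by apply: nk; exists k; auto.
  rewrite (bigD1 k) //= -[leLHS]addr0 lerD //; last first.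
    by apply: sumr_ge0 => l _; rewrite addr_ge0.
  case: kE => kE.
    rewrite -[leLHS]addr0 lerD // /H asboolT //; by exists (X e s).
  rewrite -[leLHS]add0r lerD // /H asboolT //; by exists (X e s).
under eq_bigr do rewrite big_bool.
rewrite big_split /= exchange_big /=.
have : \sum_k \sum_(e : fset_set A) (H (fsval e) k (al k) + H (fsval e) k (be k)) <=
    2 * n%:R * M.
  apply: (@le_trans _ _ (\sum_(k < n) (M + M))).
    apply: ler_sum => k _; rewrite big_split /= lerD //.
      exact: le_trans (H_le _ _) (flux_al _).
    exact: le_trans (H_le _ _) (flux_be _).
  by rewrite sumr_const card_ord -[leLHS]mulr_natr; lra.
lra.
Qed.

Lemma corner_at v : V v -> B0 v -> has_minor i j v ->
  exists (q : fset_set A * fset_set A) (s s' : bool),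
  [/\ X q.1 s = v, X q.2 s' = v, 1 <= `|wedge (w q.2) (w q.1)|
    & [\/ (w q.1).1 = 0, (w q.2).1 = 0 | s = s']].
Proof.
move=> Vv Bv [e0 [f0 [/mem_incident ve0 /mem_incident vf0 minor0]]].
have [e [f [/mem_incident ve /mem_incident vf minor side_ef]]] :=
  exists_corner (o := fun e => proj i j (outdir e v)) (sum_outdir i Vv) (sum_outdir j Vv)
    ve0 vf0 minor0.
have A_of g : incident v g -> g \in fset_set A.
  case=> Eg vg; rewrite in_fset_set ?inE; last exact: A_finite.
  by split=> //; exists v => //; case: vg.
have end_of g (vg : incident v g) : exists s,
    X [` A_of g vg]%fset s = v /\ w [` A_of g vg]%fset =
     (- side R s * (outdir g v) ord0 i, - side R s * (outdir g v) ord0 j).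
  have [s vE] := @endpoint_X [` A_of g vg]%fset v vg.2 Bv.
  exists s; split=> //; rewrite vE in Bv.
  have /rowP dirE := side_dir Bv; rewrite -vE /= in dirE.
  rewrite /w /proj.
  have h k : d [` A_of g vg]%fset ord0 k = - side R s * outdir g v ord0 k.
    have := dirE k; rewrite mxE [RHS]mxE.
    by case: (s); rewrite /= ?mul1r ?mulN1r ?opprK ?mul1r // => /oppr_inj.
  by rewrite !h.
have [s [Xs ws]] := end_of e ve; have [s' [Xs' ws']] := end_of f vf.
exists ([` A_of e ve]%fset, [` A_of f vf]%fset), s, s'; split=> //=.
  (* A nonzero minor is an integer, hence at least 1 in absolute value; reorienting the weights only
     changes its sign. *)
  rewrite ws ws'; move: minor; rewrite wedge_intvec intr_eq0 => /(intr_norm_ge1 R).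
  rewrite -wedge_intvec -/(outdir e v) -/(outdir f v).
  set a := outdir e v; set b := outdir f v.
  have -> : wedge (- side R s' * b ord0 i, - side R s' * b ord0 j)
     (- side R s * a ord0 i, - side R s * a ord0 j) =
     - (side R s * side R s') * wedge (proj i j a) (proj i j b).
    by rewrite /wedge /=; ring.
  by rewrite normrM normrN normrM !norm_side !mul1r.
case: side_ef => [h|h|h].
- by constructor 1; move/(congr1 fst): ws => /= ->; rewrite [outdir e v ord0 i]h mulr0.
- by constructor 2; move/(congr1 fst): ws' => /= ->; rewrite [outdir f v ord0 i]h mulr0.
(* Both oriented weights point rightward, so edges leaving [v] on the same side have [v] as the same
   end. *)
- constructor 3; have := orient_ge0 e; have := orient_ge0 f.
  move/(congr1 fst): ws => /= ->; move/(congr1 fst): ws' => /= ->.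
  by case: (s) (s') => [] [] //=; rewrite ?opprK ?mul1r ?mulN1r; move: h => /=; nra.
Qed.

Let VM := [set v | (V `&` B0) v /\ has_minor i j v].

Let VM_finite : finite_set VM.
Proof. by apply: sub_finite_set (tc_finite_vertices G) => v [[]]. Qed.

Lemma minor_count_param : #|` fset_set VM|%:R <= 8 * (4 * n%:R * M) ^+ 2.
Proof.
have VMP (v : fset_set VM) : VM (fsval v).
  by have := fsvalP v; rewrite in_fset_set ?inE //; apply: VM_finite.
have corner (v : fset_set VM) := corner_at (VMP v).1.1 (VMP v).1.2 (VMP v).2.
have [g gP] := fin_all_exists corner.
have int_of v (e : fset_set A) s : X e s = v -> B0 v -> ~~ bnd e s.
  by move=> <- Bv; rewrite /bnd negbK; apply/asboolP.
(* The edges of a pair are distinct, as their wedge is nonzero, so they meet only once and determine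
   the vertex. *)
have g_inj : injective g.
  move=> v v' gvv'; have [s [s' [Xe Xf ef _]]] := gP v.
  have [r [r' [Xe' Xf' _ _]]] := gP v'; rewrite -gvv' in Xe' Xf'.
  apply: val_inj => /=; apply: (@meet_unique (fsval (g v).1) (fsval (g v).2)).
  - by have [] := in_A (g v).1.
  - by have [] := in_A (g v).2.
  - move=> /val_inj eqef; move: ef; rewrite eqef (_ : wedge _ _ = 0) ?normr0 ?ler10 //.
    by rewrite /wedge; ring.
  - by rewrite -Xe; apply: eX.
  - by rewrite -Xf; apply: eX.
  - by rewrite -Xe'; apply: eX.
  - by rewrite -Xf'; apply: eX.
have W0 : 0 <= \sum_(e : fset_set A) \sum_(s | bnd e s) wnorm R (wt (fsval e)).
  by apply: sumr_ge0 => e _; apply: sumr_ge0 => s _; apply: sqrtr_ge0.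
apply: (@le_trans _ _ (8 *
   (\sum_(e : fset_set A) \sum_(s | bnd e s) wnorm R (wt (fsval e))) ^+ 2)); last first.
  rewrite ler_pM2l // lerXn2r ?nnegrE // ?boundary_flux //.
  exact: le_trans W0 boundary_flux.
rewrite cardfE.
apply: (@planar_count R _ (fun e : fset_set A => proj i j (p e)) w t bnd (al i) (be i)
  (fun e : fset_set A => wnorm R (wt (fsval e))) _ _ _ _ _ _ _ _ g) => //.
- by move=> e; apply: orient_ge0.
- by move=> e s; rewrite -X_proj; apply: BX.
- move=> F z; rewrite -[RHS](projected_balance F z).
  by apply: eq_bigr => e _; apply: eq_bigr => s _; rewrite X_proj.
- by move=> e; apply: le_wnorm; apply: orient_cases.
- by move=> e; apply: le_wnorm; apply: orient_cases.
- by move=> e s; rewrite /bnd negbK -X_proj => /asboolP/(_ i).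
- move=> v; have [s [s' [Xe Xf ef side_ef]]] := gP v; exists s, s'.
  have Bv := (VMP v).1.2; case: (g v) Xe Xf ef side_ef => e f /= Xe Xf ef side_ef.
  by split; rewrite -?X_proj ?Xe ?Xf //; [exact: int_of Xe Bv|exact: int_of Xf Bv].
Qed.

End Projection.

Lemma minor_count i j :
  #|` fset_set [set v | (V `&` B0) v /\ has_minor i j v]|%:R
    <= 8 * (4 * n%:R * M) ^+ 2.
Proof.
have h (e : fset_set A) := edge_in_box (tc_edge_cell (in_A e).1) BU
  (tc_parallel (in_A e).1) (orient_cases i (fsval e)) (in_A e).2.
have [p pP] := fin_all_exists h; have [t tP] := fin_all_exists pP.
by apply: (@minor_count_param i j p t) => e; case: (tP e).
Qed.

Lemma box_count :
  #|` fset_set (V `&` B0)|%:R <= (n * n)%:R * (8 * (4 * n%:R * M) ^+ 2).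
Proof.
have finVB : finite_set (V `&` B0) by apply: finite_setIl; apply: tc_finite_vertices.
pose P (ij : 'I_n * 'I_n) v := `[< has_minor ij.1 ij.2 v >].
have countE ij : count (P ij) (fset_set (V `&` B0)) =
    #|` fset_set [set v | (V `&` B0) v /\ has_minor ij.1 ij.2 v]|.
  rewrite -size_filter; apply/esym/perm_size; exact: perm_fset_set_sub.
have : (#|` fset_set (V `&` B0)| <= \sum_ij count (P ij) (fset_set (V `&` B0)))%N.
  under eq_bigr do rewrite -sum1_count big_mkcond.
  rewrite exchange_big /= -sum1_size big_seq [leqRHS]big_seq; apply: leq_sum => v.
  rewrite in_fset_set // inE => -[/vertex_has_minor[i [j vij]] _].
  by rewrite (bigD1 (i, j)) //= /P asboolT.
rewrite -(ler_nat R) => /le_trans; apply.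
rewrite natr_sum (@le_trans _ _ (\sum_(ij : 'I_n * 'I_n) 8 * (4 * n%:R * M) ^+ 2)) //.
  by apply: ler_sum => ij _; rewrite countE; apply: minor_count.
by rewrite sumr_const card_prod !card_ord -[leLHS]mulr_natl.
Qed.

End Curve.

(** * Choice of the box *)

Lemma wnorm_gt0 (R : realType) n (w : weight n) : 0 < wnorm R w.
Proof.
have [k wk] := row_neq0 (wrepr_neq0 w).
by apply: lt_le_trans (le_enorm _ k); rewrite mxE normr_gt0 intr_eq0.
Qed.

Section Slices.
Variables (R : realType) (n : nat) (U : set 'rV[R]_n) (G : tropical_curve U) (A : R).
Hypothesis area_le : (tc_area G <= A%:E)%E.
Local Notation E := (tc_edges G).
Local Notation wt := (tc_weight G).

Lemma enorm_le_elength (e : set 'rV[R]_n) x y : e x -> e y ->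
  ((enorm (y - x))%:E <= elength e)%E.
Proof. by move=> ex ey; apply: ereal_sup_ubound; exists x => //; exists y. Qed.

Lemma elength_ge0 e : E e -> (0 <= elength e)%E.
Proof.
move=> /tc_edge_cell/edge_nontrivial/(_ 0)[x ex _].
by apply: le_trans (enorm_le_elength ex ex); rewrite lee_fin sqrtr_ge0.
Qed.

(** Finite area and positive weights make every edge length finite. *)
Lemma sum_length_le : exists l : set 'rV[R]_n -> R,
  (forall e x y, E e -> e x -> e y -> enorm (y - x) <= l e) /\
  \sum_(e <- fset_set E) wnorm R (wt e) * l e <= A.
Proof.
have finE := tc_finite_edges G.
have areaE : tc_area G = (\sum_(e <- fset_set E) edge_area e (wt e))%E.
  by rewrite /tc_area fsbig_finite.
have area_ge0 e : E e -> (0 <= edge_area e (wt e))%E.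
  by move=> Ee; rewrite mule_ge0 ?elength_ge0 // lee_fin ltW // wnorm_gt0.
have fin_len e : E e -> elength e \is a fin_num.
  move=> Ee; rewrite ge0_fin_numE ?elength_ge0 // ltNge leye_eq; apply/negP => /eqP eoo.
  have : (edge_area e (wt e) <= A%:E)%E.
    apply: le_trans area_le; rewrite areaE (big_fsetD1 e) /=; last first.
      by rewrite in_fset_set // inE.
    rewrite leeDl // big_seq sume_ge0 // => f; rewrite in_fsetD1 in_fset_set // => /andP[_].
    by rewrite inE; apply: area_ge0.
  by rewrite /edge_area eoo gt0_mulye ?lte_fin ?wnorm_gt0 // leye_eq.
exists (fun e => fine (elength e)); split=> [e x y Ee ex ey|].
  by rewrite -lee_fin fineK ?fin_len //; apply: enorm_le_elength.
rewrite -lee_fin -sumEFin; apply: le_trans area_le; rewrite areaE.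
rewrite big_seq [leRHS]big_seq; apply: lee_sum => e; rewrite in_fset_set // inE => Ee.
by rewrite EFinM fineK ?fin_len // muleC.
Qed.

(** The [k]-th coordinates along an edge span an interval no longer than the edge, so the slice
    argument applies to these intervals. *)
Lemma exists_flux k (a b : R) : a < b ->
  exists2 s, a < s < b & flux G k s <= A / (b - a).
Proof.
move=> ab; have [l [l_ub l_sum]] := sum_length_le.
have finE := tc_finite_edges G.
have inE' (e : fset_set E) : E (fsval e).
  by have := fsvalP e; rewrite in_fset_set // inE.
pose S (e : fset_set E) : set R := [set x ord0 k | x in fsval e].
have S_diff e x y : S e x -> S e y -> x - y <= l (fsval e).
  move=> [x' ex <-] [y' ey <-]; apply: le_trans (l_ub _ _ _ (inE' e) ey ex).
  apply: le_trans (le_enorm _ k); rewrite !mxE; exact: ler_norm.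
have S0 e : S e !=set0.
  have [x ex _] := edge_nontrivial (tc_edge_cell (inE' e)) 0.
  by exists (x ord0 k); exists x.
have S_ub e : has_ubound (S e).
  have [y Sy] := S0 e; exists (y + l (fsval e)) => x Sx.
  by rewrite -lerBlDl S_diff.
have S_lb e : has_lbound (S e).
  have [y Sy] := S0 e; exists (y - l (fsval e)) => x Sx.
  by rewrite lerBlDl -lerBlDr S_diff.
have le_inf_sup e : inf (S e) <= sup (S e).
  have [y Sy] := S0 e.
  exact: le_trans (ge_inf (S_lb e) Sy) (ub_le_sup (S_ub e) Sy).
have len_le e : sup (S e) - inf (S e) <= l (fsval e).
  rewrite lerBlDl; apply: ge_sup => // x Sx.
  rewrite -lerBlDr; apply: lb_le_inf => // y Sy.
  by rewrite lerBlDl -lerBlDr S_diff.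
have [s sab Hs] := exists_slice ab
  (fun e : fset_set E => ltW (wnorm_gt0 R (wt (fsval e)))) le_inf_sup.
exists s => //; rewrite ler_pdivlMr ?subr_gt0 // mulrC.
apply: le_trans l_sum; rewrite [leRHS]big_seq_fsetE /=.
apply: le_trans (_ : _ <= \sum_(e : fset_set E)
  wnorm R (wt (fsval e)) * (sup (S e) - inf (S e))) _; last first.
  by apply: ler_sum => e _; rewrite ler_wpM2l // ltW // wnorm_gt0.
apply: le_trans Hs; rewrite ler_wpM2l ?subr_ge0 ?(ltW ab) // /flux big_seq_fsetE /=.
rewrite big_mkcond [leRHS]big_mkcond /=; apply: ler_sum => e _.
case: asboolP => [[x ex <-]|_]; last by case: ifP => // _; rewrite ltW // wnorm_gt0.
have Sx : S e (x ord0 k) by exists x.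
by rewrite (ge_inf (S_lb e) Sx) (ub_le_sup (S_ub e) Sx).
Qed.

End Slices.

(** * Local bound and compactness *)

Lemma ball_count (R : realType) (A : R) n (U : set 'rV[R]_n) x :
  open U -> U x -> exists (r : R) (N : nat), 0 < r /\
  forall G : tropical_curve U, (tc_area G <= A%:E)%E ->
    (#|` fset_set (tc_vertices G `&` ball x r)| <= N)%N.
Proof.
move=> U_open Ux.
have /nbhs_ballP[eps /= eps0 epsU] : nbhs x U by apply: open_nbhs_nbhs.
(* Halving leaves, on either side of [x], a slab of width [r] in which to choose the level; the flux
   there is at most [A / r], whence [C]. *)
pose r := eps / 2.
have r0 : 0 < r by rewrite divr_gt0.
pose C := (n * n)%:R * (8 * (4 * n%:R * (A / r)) ^+ 2).
have C0 : 0 <= C by rewrite mulr_ge0 // mulr_ge0 // sqr_ge0.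
exists r, (Num.bound C); split=> // G area_le.
have lower k : exists s, x ord0 k - eps < s < x ord0 k - r /\ flux G k s <= A / r.
  have [|s sab Fs] := @exists_flux _ _ _ G A area_le k (x ord0 k - eps) (x ord0 k - r).
    by rewrite /r; lra.
  exists s; split=> //; apply: le_trans Fs _.
  by rewrite (_ : _ - _ - _ = r) // /r; lra.
have upper k : exists s, x ord0 k + r < s < x ord0 k + eps /\ flux G k s <= A / r.
  have [|s sab Fs] := @exists_flux _ _ _ G A area_le k (x ord0 k + r) (x ord0 k + eps).
    by rewrite /r; lra.
  exists s; split=> //; apply: le_trans Fs _.
  by rewrite (_ : _ + _ - _ = r) // /r; lra.
have [al alP] := fin_all_exists lower; have [be beP] := fin_all_exists upper.
have BU : cbox al be `<=` U.
  move=> y yB; apply: epsU; split=> // i k; rewrite (ord1 i) /ball /= ltr_norml.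
  have [/andP[a1 a2] _] := alP k; have [/andP[b1 b2] _] := beP k.
  by have /andP[y1 y2] := yB k; apply/andP; split; lra.
have ballB : ball x r `<=` obox al be.
  move=> y [_ xy] k; have := xy ord0 k; rewrite /ball /= ltr_norml => /andP[y1 y2].
  have [/andP[a1 a2] _] := alP k; have [/andP[b1 b2] _] := beP k.
  by apply/andP; split; lra.
have := box_count BU (fun k => (alP k).2) (fun k => (beP k).2).
rewrite -/C => count_le; rewrite -(ler_nat R).
apply: (@le_trans _ _ (#|` fset_set (tc_vertices G `&` obox al be)|%:R)).
  have finV := tc_finite_vertices G.
  rewrite ler_nat fsubset_leq_card //; apply/fsubsetP => v.
  rewrite !in_fset_set; [|exact: finite_setIl|exact: finite_setIl].
  by rewrite !inE => -[Vv /ballB].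
by apply: le_trans count_le _; rewrite ltW // archi_boundP.
Qed.

Theorem theorem1p1 (R : realType) (A : R) (n : nat) (U K : set 'rV[R]_n)
    (A_gt0 : 0 < A) (n_ge2 : (2 <= n)%N) (U_open : open U)
    (K_compact : compact K) (K_sub_U : K `<=` U) :
  exists N : nat, forall G : tropical_curve U,
    (tc_area G <= A%:E)%E -> tc_vertices G `&` K #<= `I_N.
Proof.
have /choice[rN rNP] (x : 'rV[R]_n) : exists q : R * nat, K x -> 0 < q.1 /\
    forall G : tropical_curve U, (tc_area G <= A%:E)%E ->
      (#|` fset_set (tc_vertices G `&` ball x q.1)| <= q.2)%N.
  (* Outside [K] the value [(1, 0)] is a mere default: the cover only uses centres in [K]. *)
  have [Kx|nKx] := pselect (K x); last by exists (1, 0%N).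
  have [r [N rN]] := ball_count A U_open (K_sub_U _ Kx).
  by exists (r, N).
have [D DK KD] : finite_subset_cover K (fun x => ball x (rN x).1) K.
  move: K_compact; rewrite compact_cover; apply => [x _|x Kx]; first exact: ball_open.
  by exists x => //; apply: ballxx; have [] := rNP x Kx.
(* The bounds of a finite subcover are added; a vertex lying in several balls is merely counted
   several times. *)
exists (\sum_(x <- D) (rN x).2)%N => G area_le.
have finV := tc_finite_vertices G.
have finVI (S : set 'rV[R]_n) : finite_set (tc_vertices G `&` S) by exact: finite_setIl.
have [m Vm] := (finite_setP _).1 (finVI K).
rewrite (card_le_eql Vm) card_le_II -(card_fset_set Vm).
pose cnt (S : set 'rV[R]_n) := count (fun v => `[< S v >]) (fset_set (tc_vertices G)).
have cntE S : #|` fset_set (tc_vertices G `&` S)| = cnt S.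
  by rewrite /cnt -size_filter; apply: perm_size; apply: perm_fset_set_sub.
rewrite cntE; apply: (@leq_trans (\sum_(x <- D) cnt (ball x (rN x).1))%N); last first.
  rewrite big_seq [leqRHS]big_seq; apply: leq_sum => x xD; rewrite -cntE.
  by have [_] := rNP x (set_mem (DK x xD)); apply.
rewrite /cnt -sum1_count; under [leqRHS]eq_bigr do rewrite -sum1_count big_mkcond.
rewrite exchange_big /= big_mkcond /=; apply: leq_sum => v _.
case: asboolP => // Kv; have [x /= xD xv] := KD _ Kv.
by rewrite (big_fsetD1 x) //= asboolT.
Qed.
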